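(* Let $X$ be a second countable locally compact Hausdorff space. Then $\mathrm{dr}\,(\mathcal{C}_0(X)) = \dim X$.
   Context: Abbreviations: c.p. = completely positive; c.p.c. = completely positive contractive. Covering dimension: the order of a family $(U_\lambda)_{\lambda\in\Lambda}$ of subsets of a topological space $X$ does not exceed $n$ if $\bigcap_{i=0}^{n+1} U_{\lambda_i} = \emptyset$ for any $n+2$ distinct indices $\lambda_0,\ldots,\lambda_{n+1}$. We say $\dim X \le n$ if every finite open covering of $X$ has an open refinement of order not exceeding $n$; $\dim X$ is the least such integer $n$ (and $\infty$ if there is none). Order zero: a c.p. map $\varphi : F \to A$ from a finite-dimensional $C^*$-algebra $F$ to a $C^*$-algebra $A$ has strict order zero if $\varphi(e)\varphi(e')=0$ for any two orthogonal minimal projections $e, e' \in F$. $n$-decomposable: a c.p. map $\varphi : \bigoplus_{i=1}^s M_{r_i} \to A$ is $n$-decomposable if there is a decomposition $\{1,\ldots,s\} = \coprod_{j=0}^n I_j$ such that the restriction of $\varphi$ to $\bigoplus_{i \in I_j} M_{r_i}$ has strict order zero for each $j \in \{0,\ldots,n\}$. A c.p. approximation $(F,\psi,\varphi)$ (of $A$) for $b_1,\ldots,b_m \in A$ within $\varepsilon$ consists of a finite-dimensional $C^*$-algebra $F$ and c.p.c. maps $\psi : A \to F$, $\varphi : F \to A$ with $\|\varphi\psi(b_i) - b_i\| < \varepsilon$ for all $i$. Decomposition rank: for a separable $C^*$-algebra $A$, $\mathrm{dr}\,A$ is the least integer $n \geq 0$ such that for every finite set $\{b_1,\ldots,b_m\}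 \subset A$ and every $\varepsilon > 0$ there is a c.p. approximation $(F,\psi,\varphi)$ of $A$ for $b_1,\ldots,b_m$ within $\varepsilon$ with $\varphi$ $n$-decomposable; $\mathrm{dr}\,A = \infty$ if no such $n$ exists. *)

(* Defs.v *)
From HB Require Import structures.
From mathcomp Require Import all_boot all_order all_algebra.
From mathcomp Require Import all_classical all_reals all_analysis.
From mathcomp Require Import complex ring lra.

Set Implicit Arguments.
Unset Strict Implicit.
Unset Printing Implicit Defensive.

Import Order.TTheory GRing.Theory Num.Theory numFieldNormedType.Exports.

Local Open Scope classical_set_scope.
Local Open Scope ring_scope.

Notation normc := Normc.normc.

Reserved Notation "x ** y" (at level 40, left associativity).

(** C*-algebras need not be unital, so this structure does not extend the
    (unital) [algType]. *)
HB.mixin Record CompleteNormedModule_isCStarAlgebra (R : realType) A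
    & CompleteNormedModule R[i] A := {
  cmul : A -> A -> A;
  star : A -> A;
  cmulA : associative cmul;
  cmulDl : left_distributive cmul +%R;
  cmulDr : right_distributive cmul +%R;
  cmulZl : forall (k : R[i]) x y, cmul (k *: x) y = k *: cmul x y;
  cmulZr : forall (k : R[i]) x y, cmul x (k *: y) = k *: cmul x y;
  starK : involutive star;
  starD : {morph star : x y / x + y};
  starZ : forall (k : R[i]) x, star (k *: x) = Num.conj k *: star x;
  starM : forall x y, star (cmul x y) = cmul (star y) (star x);
  norm_cmul_le : forall x y, `|cmul x y| <= `|x| * `|y|;
  norm_cstar : forall x, `|cmul (star x) x| = `|x| ^+ 2
}.

#[short(type="cstarAlgType")]
HB.structure Definition CStarAlgebra (R : realType) :=
  {A of CompleteNormedModule R[i] A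
      & CompleteNormedModule_isCStarAlgebra R A}.

Notation "x ** y" := (cmul x y) : ring_scope.

Section Complex.
Variable R : realType.
Implicit Types (z w : R[i]) (e : R).

Lemma normE z : `|z| = (normc z)%:C%C. Proof. by []. Qed.

Lemma normc_ge0 z : 0 <= normc z.
Proof. by case: z => a b; exact: sqrtr_ge0. Qed.

Lemma normcD z w : normc (z + w) <= normc z + normc w.
Proof. by rewrite -lecR rmorphD /= -!normE ler_normD. Qed.

Lemma normcN z : normc (- z) = normc z.
Proof. by apply: complexI; rewrite -!normE normrN. Qed.

Lemma normcB z w : normc (z - w) = normc (w - z).
Proof. by rewrite -normcN opprB. Qed.

Lemma normc_conj z : normc (Num.conj z) = normc z.
Proof. by apply: complexI; rewrite -!normE norm_conjC. Qed.

Lemma normc_dist z w : `|normc z - normc w| <= normc (z - w).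
Proof.
rewrite ler_norml lerNl opprB !lerBlDr; apply/andP; split.
  by rewrite normcB -{1}(subrK z w); exact: normcD.
by rewrite -{1}(subrK w z); exact: normcD.
Qed.

Lemma gt0_complex (k : R[i]) : 0 < k -> exists2 e, 0 < e & k = e%:C%C.
Proof. by case: k => a b; rewrite ltcE /= => /andP[/eqP-> a0]; exists a. Qed.

Lemma continuous_complexP (X : topologicalType) (f : X -> R[i]^o) :
  continuous f <->
  forall x e, 0 < e -> \forall y \near x, normc (f x - f y) < e.
Proof.
split=> [cf x e e0|cf x].
  have /cvgrPdist_lt /(_ e%:C%C) := cf x.
  by rewrite ltcR => /(_ e0); apply: filterS => y; rewrite normE ltcR.
apply/cvgrPdist_lt => _ /gt0_complex[e e0 ->].
by move: (cf x e e0); apply: filterS => y; rewrite normE ltcR.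
Qed.

Lemma continuous_normc (X : topologicalType) (f : X -> R[i]^o) :
  continuous f -> continuous (fun x => normc (f x)).
Proof.
move=> /continuous_complexP cf x; apply/cvgrPdist_lt => e e0.
by move: (cf x e e0); apply: filterS => y; exact/le_lt_trans/normc_dist.
Qed.

Lemma cauchy_eval (V : normedModType R[i]) (F : set_system V) :
  ProperFilter F -> cauchy F -> forall e, 0 < e ->
  exists2 A, F A & forall u v, A u -> A v -> `|u - v| < e%:C%C.
Proof.
move=> FF /cauchyP Fc e e0.
have [|x Fx] := Fc (e / 2)%:C%C; first by rewrite ltcR divr_gt0.
exists (ball x (e / 2)%:C%C) => // u v; rewrite -ball_normE /= => xu xv.
rewrite -(subrK x u) -addrA (le_lt_trans (ler_normD _ _))//.
by rewrite [e in ltRHS]splitr rmorphD /= ltrD// distrC.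
Qed.

Lemma complex_complete (G : set_system R[i]) : ProperFilter G ->
  (forall e, 0 < e ->
    exists2 A, G A & forall z w, A z -> A w -> normc (z - w) < e) ->
  exists l, forall e, 0 < e -> G [set z | normc (z - l) < e].
Proof.
move=> GF Gc.
have part (p : R[i] -> R) : (forall z w, `|p z - p w| <= normc (z - w)) ->
    exists l, forall e, 0 < e -> G [set z | `|p z - l| < e].
  move=> pl.
  have : cvg (p @ G).
    apply/cauchy_cvgP/cauchyP => e e0; have [A GA HA] := Gc e e0.
    have [z Az] := filter_ex GA; exists (p z).
    rewrite -ball_normE /=; apply: filterS GA => w Aw /=.
    exact: le_lt_trans (pl _ _) (HA _ _ Az Aw).
  move=> /cvg_ex[l /cvgrPdist_lt pGl]; exists l => e /pGl.
  by apply: filterS => z /=; rewrite distrC.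
have le_norm (a b : R) : `|a| <= normc (a +i* b)%C /\ `|b| <= normc (a +i* b)%C.
  by rewrite /= -!sqrtr_sqr !ler_sqrt ?addr_ge0 ?sqr_ge0// lerDl lerDr !sqr_ge0.
have [|a Ga] := part (@complex.Re R).
  by move=> [a b] [c d] /=; have [] := le_norm (a - c) (b - d).
have [|b Gb] := part (@complex.Im R).
  by move=> [a' b] [c d] /=; have [] := le_norm (a' - c) (b - d).
exists (a +i* b)%C => e e0; have e20 : 0 < e / 2 by rewrite divr_gt0.
have norm_le (x y : R) : normc (x +i* y)%C <= `|x| + `|y|.
  rewrite (_ : (x +i* y)%C = x%:C%C + (0 +i* y)%C).
    by rewrite (le_trans (normcD _ _))//= expr0n /= addr0 add0r !sqrtr_sqr.
  by apply/eqP; rewrite eq_complex /= addr0 add0r !eqxx.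
apply: filterS (filterI (Ga _ e20) (Gb _ e20)) => -[c d] [ca db].
by apply: le_lt_trans (norm_le _ _) _; rewrite [e]splitr ltrD.
Qed.

(** A Cauchy filter converges uniformly along any family of 1-Lipschitz
    evaluations. *)
Lemma cauchy_pointwise (V : normedModType R[i]) (T : Type)
    (ev : T -> V -> R[i]) (F : set_system V) :
  (forall t u v, (normc (ev t u - ev t v))%:C%C <= `|u - v|) ->
  ProperFilter F -> cauchy F ->
  exists l : T -> R[i], forall e, 0 < e ->
    exists2 A, F A & forall u t, A u -> normc (ev t u - l t) <= e.
Proof.
move=> evl FF Fc.
have lim t : exists l, forall e, 0 < e -> F [set u | normc (ev t u - l) < e].
  apply: (@complex_complete (ev t @ F)) => e e0.
  have [A FA HA] := cauchy_eval FF Fc e0.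
  exists (ev t @` A).
    have : F (ev t @^-1` (ev t @` A)) by apply: filterS FA => u Au /=; exists u.
    by [].
  move=> _ _ [u Au <-] [v Av <-].
  by rewrite -ltcR (le_lt_trans (evl _ _ _))// HA.
pose l t := projT1 (cid (lim t)).
exists l => e e0; have [A FA HA] := cauchy_eval FF Fc e0.
exists A => // u t Au; apply/ler_addgt0Pr => d d0.
have := projT2 (cid (lim t)) d d0; rewrite -/(l t) => Fl.
have [v [Av /= vl]] := filter_ex (filterI FA Fl).
rewrite -(subrK (ev t v) (ev t u)) -addrA (le_trans (normcD _ _))//.
rewrite lerD// ?ltW// -ltcR (le_lt_trans (evl _ _ _))//; exact: HA.
Qed.

End Complex.

Record C0 (R : realType) (X : topologicalType) := MkC0 {
  C0_fun :> X -> R[i]^o;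
  C0_continuous : continuous C0_fun;
  C0_vanish : forall e : R, 0 < e -> compact [set x | e%:C%C <= `|C0_fun x|]
}.

Section C0.
Variables (R : realType) (X : topologicalType).
Implicit Types (f g h : C0 R X) (e : R).

Lemma C0_eq f g : (forall x, f x = g x) -> f = g.
Proof.
case: f => f cf vf; case: g => g cg vg /= /funext fg.
case: _ / fg in cg vg *.
by rewrite (Prop_irrelevance cf cg) (Prop_irrelevance vf vg).
Qed.

Lemma C0_closed (f : X -> R[i]^o) e :
  continuous f -> closed [set x | e%:C%C <= `|f x|].
Proof.
move=> /continuous_normc cf.
have -> : [set x | e%:C%C <= `|f x|] = (fun x => normc (f x)) @^-1` [set y | e <= y].
  by apply/seteqP; split=> x /=; rewrite normE lecR.
by apply: closed_comp => [x _|]; [exact: cf|exact: closed_ge].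
Qed.

Lemma C0_vanish_le (f : X -> R[i]^o) (K : R -> set X) :
  continuous f ->
  (forall e, 0 < e -> compact (K e)) ->
  (forall e x, 0 < e -> ~ K e x -> normc (f x) < e) ->
  forall e, 0 < e -> compact [set x | e%:C%C <= `|f x|].
Proof.
move=> cf cK HK e e0; apply: subclosed_compact (cK e e0) _.
  exact: C0_closed.
move=> x /=; rewrite normE lecR leNgt => /negP fx.
by apply: contrapT => /(HK _ _ e0).
Qed.

Lemma C0_bounded f : exists2 M : R, 0 < M & forall x, normc (f x) <= M.
Proof.
have /continuous_normc cf := @C0_continuous _ _ f.
have : compact ((fun x => normc (f x)) @` [set x | 1%:C%C <= `|f x|]).
  apply: continuous_compact; last exact: C0_vanish.
  exact: continuous_subspaceT.
move=> /compact_bounded /= [M [_ HM]].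
have M1 : M < Num.max 1 (M + 1) by rewrite lt_max ltrDl ltr01 orbT.
exists (Num.max 1 (M + 1)) => [|x]; first by rewrite lt_max ltr01.
have [f1|f1] := leP 1 (normc (f x)); last by rewrite le_max (ltW f1).
apply: le_trans (ler_norm _) (HM _ M1 _ _).
by exists x => //=; rewrite normE lecR.
Qed.

Lemma C0_zero_subproof1 : continuous (fun _ : X => 0 : R[i]^o).
Proof. by move=> x; exact: cvg_cst. Qed.

Lemma C0_zero_subproof2 e :
  0 < e -> compact [set x : X | e%:C%C <= `|0 : R[i]^o|].
Proof.
move=> e0; rewrite (_ : [set _ | _] = set0); first exact: compact0.
by rewrite -subset0 => x /=; rewrite normr0 lecR leNgt e0.
Qed.

Definition C0_zero : C0 R X := MkC0 C0_zero_subproof1 C0_zero_subproof2.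

Lemma C0_add_subproof1 f g : continuous (fun x => f x + g x : R[i]^o).
Proof. by move=> x; apply: cvgD; exact: C0_continuous. Qed.

Lemma C0_add_subproof2 f g e :
  0 < e -> compact [set x | e%:C%C <= `|f x + g x : R[i]^o|].
Proof.
move: e; pose K h e := [set x | (e / 2)%:C%C <= `|h x|].
apply: (@C0_vanish_le _ (fun e => K f e `|` K g e)).
- exact: C0_add_subproof1.
- by move=> e e0; apply: compactU; apply: C0_vanish; rewrite divr_gt0.
move=> e x e0 /not_orP[]; rewrite /K /= !normE !lecR.
move=> /negP; rewrite -ltNge => fx /negP; rewrite -ltNge => gx.
by rewrite (le_lt_trans (normcD _ _))// [e]splitr ltrD.
Qed.

Definition C0_add f g : C0 R X :=
  MkC0 (@C0_add_subproof1 f g) (@C0_add_subproof2 f g).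

Lemma C0_scale_subproof1 (k : R[i]) f : continuous (fun x => k * f x : R[i]^o).
Proof. by move=> x; apply: cvgMr; exact: C0_continuous. Qed.

Lemma C0_scale_subproof2 (k : R[i]) f e :
  0 < e -> compact [set x | e%:C%C <= `|k * f x : R[i]^o|].
Proof.
move: e; pose M : R := normc k + 1.
have M0 : 0 < M by rewrite ltr_wpDl ?normc_ge0.
apply: (@C0_vanish_le _ (fun e => [set x | (e / M)%:C%C <= `|f x|])).
- exact: C0_scale_subproof1.
- by move=> e e0; apply: C0_vanish; rewrite divr_gt0.
move=> e x e0 /=; rewrite normE lecR => /negP; rewrite -ltNge ltr_pdivlMr//.
apply: le_lt_trans; rewrite Normc.normcM mulrC ler_wpM2l ?normc_ge0//.
by rewrite lerDl.
Qed.

Definition C0_scale (k : R[i]) f : C0 R X :=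
  MkC0 (@C0_scale_subproof1 k f) (@C0_scale_subproof2 k f).

Lemma C0_mul_subproof1 f g : continuous (fun x => f x * g x : R[i]^o).
Proof. by move=> x; apply: cvgM; exact: C0_continuous. Qed.

Lemma C0_mul_subproof2 f g e :
  0 < e -> compact [set x | e%:C%C <= `|f x * g x : R[i]^o|].
Proof.
have [M M0 fM] := C0_bounded f; move: e.
apply: (@C0_vanish_le _ (fun e => [set x | (e / M)%:C%C <= `|g x|])).
- exact: C0_mul_subproof1.
- by move=> e e0; apply: C0_vanish; rewrite divr_gt0.
move=> e x e0 /=; rewrite normE lecR => /negP; rewrite -ltNge ltr_pdivlMr//.
apply: le_lt_trans; rewrite Normc.normcM mulrC ler_wpM2l ?normc_ge0//.
Qed.

Definition C0_mul f g : C0 R X :=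
  MkC0 (@C0_mul_subproof1 f g) (@C0_mul_subproof2 f g).

Lemma C0_star_subproof1 f : continuous (fun x => Num.conj (f x) : R[i]^o).
Proof.
apply/continuous_complexP => x e e0.
have /continuous_complexP /(_ x e e0) := @C0_continuous _ _ f.
by apply: filterS => y; rewrite -rmorphB normc_conj.
Qed.

Lemma C0_star_subproof2 f e :
  0 < e -> compact [set x | e%:C%C <= `|Num.conj (f x) : R[i]^o|].
Proof.
move=> e0; rewrite (_ : [set _ | _] = [set x | e%:C%C <= `|f x|]).
  exact: C0_vanish.
by apply/seteqP; split=> x /=; rewrite norm_conjC.
Qed.

Definition C0_star f : C0 R X :=
  MkC0 (@C0_star_subproof1 f) (@C0_star_subproof2 f).

HB.instance Definition _ := gen_eqMixin (C0 R X).
HB.instance Definition _ := gen_choiceMixin (C0 R X).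

Lemma C0_addA : associative C0_add.
Proof. by move=> f g h; apply: C0_eq => x /=; rewrite addrA. Qed.
Lemma C0_addC : commutative C0_add.
Proof. by move=> f g; apply: C0_eq => x /=; rewrite addrC. Qed.
Lemma C0_add0 : left_id C0_zero C0_add.
Proof. by move=> f; apply: C0_eq => x /=; rewrite add0r. Qed.
Lemma C0_addN : left_inverse C0_zero (C0_scale (-1)) C0_add.
Proof. by move=> f; apply: C0_eq => x /=; rewrite mulN1r addNr. Qed.

HB.instance Definition _ :=
  GRing.isZmodule.Build (C0 R X) C0_addA C0_addC C0_add0 C0_addN.

Lemma C0_scaleA k l f : C0_scale k (C0_scale l f) = C0_scale (k * l) f.
Proof. by apply: C0_eq => x /=; rewrite mulrA. Qed.
Lemma C0_scale1 : left_id 1 C0_scale.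
Proof. by move=> f; apply: C0_eq => x /=; rewrite mul1r. Qed.
Lemma C0_scaleDr : right_distributive C0_scale +%R.
Proof. by move=> k f g; apply: C0_eq => x /=; rewrite mulrDr. Qed.
Lemma C0_scaleDl f : {morph C0_scale^~ f : k l / k + l}.
Proof. by move=> k l; apply: C0_eq => x /=; rewrite mulrDl. Qed.

HB.instance Definition _ := GRing.Zmodule_isLmodule.Build R[i] (C0 R X)
  C0_scaleA C0_scale1 C0_scaleDr C0_scaleDl.

Lemma C0_subE f g x : (f - g) x = f x - g x.
Proof. by rewrite /= -[LHS]/(f x + -1 * g x) mulN1r. Qed.

(** [sup set0 = 0], so that the norm is also right for empty [X]. *)
Definition C0_norm f : R := sup (range (fun x => normc (f x))).

Lemma C0_norm_ub f x : normc (f x) <= C0_norm f.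
Proof.
apply: sup_upper_bound; last by exists x.
split; first by exists (normc (f x)), x.
by have [M _ fM] := C0_bounded f; exists M => _ [y _ <-].
Qed.

Lemma C0_norm_le f (M : R) :
  0 <= M -> (forall x, normc (f x) <= M) -> C0_norm f <= M.
Proof.
move=> M0 fM; have [x|X0] := pselect (exists x : X, True); last first.
  rewrite /C0_norm (_ : range (fun x => normc (f x)) = set0) ?sup0//.
  by rewrite -subset0 => y [x _ _]; apply: X0; exists x.
by apply: ge_sup => [|_ [y _ <-]//]; case: x => x _; exists (normc (f x)), x.
Qed.

Lemma C0_norm_ge0 f : 0 <= C0_norm f.
Proof.
have [[x _]|X0] := pselect (exists x : X, True).
  exact: le_trans (normc_ge0 _) (C0_norm_ub f x).
rewrite /C0_norm (_ : range (fun x => normc (f x)) = set0) ?sup0//.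
by rewrite -subset0 => y [x _ _]; apply: X0; exists x.
Qed.

Lemma C0_normD f g :
  (C0_norm (f + g))%:C%C <= (C0_norm f)%:C%C + (C0_norm g)%:C%C :> R[i].
Proof.
rewrite -rmorphD /= lecR C0_norm_le ?addr_ge0 ?C0_norm_ge0// => x.
by rewrite (le_trans (normcD _ _))// lerD ?C0_norm_ub.
Qed.

Lemma C0_normZ (k : R[i]) f :
  (C0_norm (k *: f))%:C%C = `|k| * (C0_norm f)%:C%C :> R[i].
Proof.
rewrite normE -rmorphM /=; congr (_%:C)%C.
have le k' f' : C0_norm (k' *: f') <= normc k' * C0_norm f'.
  rewrite C0_norm_le ?mulr_ge0 ?normc_ge0 ?C0_norm_ge0// => x.
  by rewrite Normc.normcM ler_wpM2l ?normc_ge0 ?C0_norm_ub.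
apply/eqP; rewrite eq_le le /=; have [->|k0] := eqVneq k 0.
  by rewrite Normc.normc0 mul0r C0_norm_ge0.
have nk0 : 0 < normc k by rewrite -ltcR -normE normr_gt0.
rewrite -ler_pdivlMl// -Normc.normcV (le_trans _ (le _ _))//.
by rewrite scalerA mulVf// scale1r.
Qed.

Lemma C0_norm0_eq0 f : (C0_norm f)%:C%C = 0 :> R[i] -> f = 0.
Proof.
move=> /(@complexI _ _ 0) f0; apply: C0_eq => x; apply: Normc.eq0_normc.
by apply/eqP; rewrite eq_le normc_ge0 -f0 C0_norm_ub.
Qed.

HB.instance Definition _ := Lmodule_isNormed.Build R[i] (C0 R X)
  C0_normD C0_normZ C0_norm0_eq0.

Lemma C0_normE f : `|f| = (C0_norm f)%:C%C. Proof. by []. Qed.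

Lemma C0_complete (F : set_system (C0 R X)) :
  ProperFilter F -> cauchy F -> cvg F.
Proof.
move=> FF Fc.
have [|l Fl] := @cauchy_pointwise R (C0 R X) X (fun x f => f x) F _ FF Fc.
  by move=> x f g; rewrite C0_normE lecR -C0_subE C0_norm_ub.
have near_l e : 0 < e -> exists f, forall x, normc (f x - l x) <= e.
  by move=> /Fl[A FA HA]; have [f Af] := filter_ex FA; exists f => x; exact: HA.
have lc : continuous (l : X -> R[i]^o).
  apply/continuous_complexP => x e e0; have e30 : 0 < e / 3 by rewrite divr_gt0.
  have [f fl] := near_l _ e30.
  have /continuous_complexP /(_ x _ e30) := @C0_continuous _ _ f.
  apply: filterS => y fxy.
  have -> : l x - l y = (l x - f x) + ((f x - f y) + (f y - l y)).
    by rewrite addrA subrKA subrKA.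
  rewrite (le_lt_trans (normcD _ _))//.
  have := normcD (f x - f y) (f y - l y); have := fl x; have := fl y.
  rewrite (normcB (l x)); lra.
have lv e : 0 < e -> compact [set x | e%:C%C <= `|l x : R[i]^o|].
  have half (d : R) : 0 < d -> 0 < d / 2 by move=> d0; rewrite divr_gt0.
  move: e; pose f e (e0 : 0 < e) := projT1 (cid (near_l (e / 2) (half _ e0))).
  pose K e := [set x | exists e0 : 0 < e, (e / 2)%:C%C <= `|f e e0 x|].
  apply: (@C0_vanish_le _ K) => // [e e0|e x e0].
    rewrite (_ : K e = [set x | (e / 2)%:C%C <= `|f e e0 x|]).
      by apply: C0_vanish; rewrite divr_gt0.
    apply/seteqP; split=> x /= => [[e0']|]; last by exists e0.
    by rewrite (bool_irrelevance e0' e0).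
  move=> /forallNP /(_ e0) /negP; rewrite normE lecR -ltNge => fx.
  rewrite -(subrK (f e e0 x) (l x)) (le_lt_trans (normcD _ _))//.
  rewrite [e in ltRHS]splitr ler_ltD// normcB.
  exact: projT2 (cid (near_l (e / 2) (half _ e0))) x.
apply/cvg_ex; exists (MkC0 lc lv); apply/cvgrPdist_le => _ /gt0_complex[e e0 ->].
have [A FA HA] := Fl e e0; apply: filterS FA => f Af.
rewrite C0_normE lecR C0_norm_le ?ltW// => x.
by rewrite C0_subE normcB HA.
Qed.

HB.instance Definition _ := Uniform_isComplete.Build (C0 R X) C0_complete.

Lemma C0_mulA : associative C0_mul.
Proof. by move=> f g h; apply: C0_eq => x /=; rewrite mulrA. Qed.
Lemma C0_mulDl : left_distributive C0_mul +%R.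
Proof. by move=> f g h; apply: C0_eq => x /=; rewrite mulrDl. Qed.
Lemma C0_mulDr : right_distributive C0_mul +%R.
Proof. by move=> f g h; apply: C0_eq => x /=; rewrite mulrDr. Qed.
Lemma C0_mulZl (k : R[i]) f g : C0_mul (k *: f) g = k *: C0_mul f g.
Proof. by apply: C0_eq => x /=; rewrite mulrA. Qed.
Lemma C0_mulZr (k : R[i]) f g : C0_mul f (k *: g) = k *: C0_mul f g.
Proof. by apply: C0_eq => x /=; rewrite mulrCA. Qed.
Lemma C0_starK : involutive C0_star.
Proof. by move=> f; apply: C0_eq => x /=; rewrite conjCK. Qed.
Lemma C0_starD : {morph C0_star : f g / f + g}.
Proof. by move=> f g; apply: C0_eq => x /=; rewrite rmorphD. Qed.
Lemma C0_starZ (k : R[i]) f : C0_star (k *: f) = Num.conj k *: C0_star f.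
Proof. by apply: C0_eq => x /=; rewrite rmorphM. Qed.
Lemma C0_starM f g : C0_star (C0_mul f g) = C0_mul (C0_star g) (C0_star f).
Proof. by apply: C0_eq => x /=; rewrite rmorphM mulrC. Qed.

Lemma C0_norm_mul f g : `|C0_mul f g| <= `|f| * `|g|.
Proof.
rewrite !C0_normE -rmorphM /= lecR.
rewrite C0_norm_le ?mulr_ge0 ?C0_norm_ge0// => x.
by rewrite Normc.normcM ler_pM ?normc_ge0 ?C0_norm_ub.
Qed.

Lemma C0_norm_star f : `|C0_mul (C0_star f) f| = `|f| ^+ 2.
Proof.
apply/eqP; rewrite eq_le; apply/andP; split.
  rewrite (le_trans (C0_norm_mul _ _))// expr2 ler_wpM2r//.
  rewrite !C0_normE lecR C0_norm_le ?C0_norm_ge0// => x.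
  by rewrite /= normc_conj C0_norm_ub.
rewrite !C0_normE -rmorphXn /= lecR -[leRHS]sqr_sqrtr ?C0_norm_ge0//.
rewrite ler_pXn2r ?nnegrE ?C0_norm_ge0 ?sqrtr_ge0//.
rewrite C0_norm_le ?sqrtr_ge0// => x.
rewrite -(ger0_norm (normc_ge0 (f x))) -sqrtr_sqr ler_sqrt ?C0_norm_ge0//.
rewrite (le_trans _ (C0_norm_ub _ x))//=.
by rewrite Normc.normcM normc_conj expr2.
Qed.

HB.instance Definition _ :=
  CompleteNormedModule_isCStarAlgebra.Build R (C0 R X)
    C0_mulA C0_mulDl C0_mulDr C0_mulZl C0_mulZr
    C0_starK C0_starD C0_starZ C0_starM C0_norm_mul C0_norm_star.

End C0.

Section OperatorNorm.
Variable R : realType.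
Implicit Types (n : nat) (e M : R).

Definition l2norm n (v : 'cV[R[i]]_n) : R :=
  Num.sqrt (\sum_j normc (v j ord0) ^+ 2).

Definition opnorm n (x : 'M[R[i]]_n) : R :=
  sup [set l2norm (x *m v) | v in [set v | l2norm v <= 1]].

Definition adjoint n m (x : 'M[R[i]]_(n, m)) : 'M[R[i]]_(m, n) :=
  (map_mx Num.conj x)^T.

Lemma real_CauchySchwarz n (a b : 'I_n -> R) :
  (\sum_j a j * b j) ^+ 2 <= (\sum_j a j ^+ 2) * (\sum_j b j ^+ 2).
Proof.
set S := \sum_j a j * b j; set A := \sum_j a j ^+ 2; set B := \sum_j b j ^+ 2.
have B0 : 0 <= B by apply: sumr_ge0 => j _; exact: sqr_ge0.
have := B0; rewrite le_eqVlt => /orP[/eqP B00|Bgt0].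
  rewrite -B00 mulr0 /S big1 ?expr0n// => j _.
  have /eqP : B = 0 by rewrite -B00.
  rewrite psumr_eq0 => [/allP /(_ j)|k _]; last exact: sqr_ge0.
  by rewrite mem_index_enum sqrf_eq0 => /(_ isT) /eqP ->; rewrite mulr0.
rewrite -subr_ge0 -(pmulr_rge0 _ Bgt0).
have -> : B * (A * B - S ^+ 2) = \sum_j (B * a j - S * b j) ^+ 2.
  have E j : (B * a j - S * b j) ^+ 2 =
      B ^+ 2 * a j ^+ 2 - 2 * B * S * (a j * b j) + S ^+ 2 * b j ^+ 2 by ring.
  rewrite (eq_bigr _ (fun j _ => E j)) big_split sumrB /= -!mulr_sumr.
  by rewrite -/A -/B -/S; ring.
by apply: sumr_ge0 => j _; exact: sqr_ge0.
Qed.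

Lemma l2norm_ge0 n (v : 'cV[R[i]]_n) : 0 <= l2norm v.
Proof. exact: sqrtr_ge0. Qed.

Lemma l2norm_sqr n (v : 'cV[R[i]]_n) : l2norm v ^+ 2 = \sum_j normc (v j ord0) ^+ 2.
Proof. by rewrite sqr_sqrtr// sumr_ge0// => j _; exact: sqr_ge0. Qed.

Lemma l2norm_le n (v : 'cV[R[i]]_n) M :
  0 <= M -> \sum_j normc (v j ord0) ^+ 2 <= M ^+ 2 -> l2norm v <= M.
Proof.
by move=> M0; rewrite -l2norm_sqr ler_pXn2r// nnegrE ?l2norm_ge0.
Qed.

Lemma le_l2norm n (u v : 'cV[R[i]]_n) :
  \sum_j normc (u j ord0) * normc (v j ord0) <= l2norm u * l2norm v.
Proof.
rewrite -(@ler_pXn2r _ 2) ?nnegrE ?mulr_ge0 ?l2norm_ge0//; last first.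
  by apply: sumr_ge0 => j _; rewrite mulr_ge0 ?normc_ge0.
by rewrite exprMn !l2norm_sqr real_CauchySchwarz.
Qed.

Lemma normc_sum (I : Type) (s : seq I) (f : I -> R[i]) :
  normc (\sum_(j <- s) f j) <= \sum_(j <- s) normc (f j).
Proof.
elim/big_rec2: _ => [|j x y _ xy]; first by rewrite Normc.normc0.
by rewrite (le_trans (normcD _ _))// lerD2l.
Qed.

Lemma l2normD n (u v : 'cV[R[i]]_n) : l2norm (u + v) <= l2norm u + l2norm v.
Proof.
apply: l2norm_le; first by rewrite addr_ge0 ?l2norm_ge0.
rewrite sqrrD !l2norm_sqr.
apply: (@le_trans _ _ (\sum_j (normc (u j ord0) + normc (v j ord0)) ^+ 2)).
  apply: ler_sum => j _; rewrite ler_pXn2r ?nnegrE ?addr_ge0 ?normc_ge0//.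
  by rewrite mxE normcD.
under eq_bigr => j _ do rewrite sqrrD.
rewrite !big_split /= lerD2r lerD2l -mulr2n.
by rewrite lerMn2r le_l2norm orbT.
Qed.

Lemma l2normZ n (k : R[i]) (v : 'cV[R[i]]_n) : l2norm (k *: v) = normc k * l2norm v.
Proof.
rewrite /l2norm; under eq_bigr => j _ do rewrite mxE Normc.normcM exprMn.
rewrite -mulr_sumr sqrtrM ?sqr_ge0// sqrtr_sqr ger0_norm//; exact: normc_ge0.
Qed.

Lemma l2norm0 n : l2norm (0 : 'cV[R[i]]_n) = 0.
Proof.
rewrite /l2norm big1 ?sqrtr0// => j _.
by rewrite mxE Normc.normc0 expr0n.
Qed.

Lemma normc_entry n (v : 'cV[R[i]]_n) j : normc (v j ord0) <= l2norm v.
Proof.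
rewrite -(ger0_norm (normc_ge0 _)) -sqrtr_sqr ler_sqrt.
  by rewrite (bigD1 j)//= lerDl sumr_ge0// => k _; exact: sqr_ge0.
by rewrite sumr_ge0// => k _; exact: sqr_ge0.
Qed.

Lemma l2norm_eq0 n (v : 'cV[R[i]]_n) : l2norm v = 0 -> v = 0.
Proof.
move=> v0; apply/colP => j; rewrite mxE; apply: Normc.eq0_normc.
by apply/eqP; rewrite eq_le normc_ge0 -v0 normc_entry.
Qed.

Lemma l2norm_le_sum n (v : 'cV[R[i]]_n) : l2norm v <= \sum_j normc (v j ord0).
Proof.
apply: l2norm_le; first by apply: sumr_ge0 => j _; exact: normc_ge0.
suff [] : (0 <= \sum_j normc (v j ord0)) /\
    \sum_j normc (v j ord0) ^+ 2 <= (\sum_j normc (v j ord0)) ^+ 2 by [].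
elim/big_rec2: _ => [|j x y _ [y0 xy]]; first by rewrite expr0n.
split; first by rewrite addr_ge0 ?normc_ge0.
rewrite sqrrD -addrA lerD2l (le_trans xy)// lerDr mulrn_wge0// mulr_ge0//.
exact: normc_ge0.
Qed.

Lemma l2norm_mulmx n (x : 'M[R[i]]_n) (v : 'cV[R[i]]_n) :
  l2norm (x *m v) <= (\sum_j \sum_k normc (x j k)) * l2norm v.
Proof.
rewrite (le_trans (l2norm_le_sum _))// mulr_suml ler_sum// => j _.
rewrite mxE (le_trans (normc_sum _ _))// mulr_suml ler_sum// => k _.
by rewrite Normc.normcM ler_wpM2l ?normc_ge0 ?normc_entry.
Qed.

Lemma sum_normc_ge0 n (x : 'M[R[i]]_n) : 0 <= \sum_j \sum_k normc (x j k).
Proof. by do 2![apply: sumr_ge0 => ? _]; exact: normc_ge0. Qed.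

Lemma opnorm_le n (x : 'M[R[i]]_n) M :
  (forall v : 'cV[R[i]]_n, l2norm v <= 1 -> l2norm (x *m v) <= M) -> opnorm x <= M.
Proof.
move=> xM; apply: ge_sup => [|_ [v v1 <-]]; last exact: xM.
by exists (l2norm (x *m 0)), 0; rewrite //= l2norm0 ler01.
Qed.

Lemma opnorm_ub1 n (x : 'M[R[i]]_n) (v : 'cV[R[i]]_n) :
  l2norm v <= 1 -> l2norm (x *m v) <= opnorm x.
Proof.
move=> v1; apply: sup_upper_bound; last by exists v.
split; first by exists (l2norm (x *m v)), v.
exists (\sum_j \sum_k normc (x j k)) => _ [u /= u1 <-].
by rewrite (le_trans (l2norm_mulmx _ _))// ler_piMr ?sum_normc_ge0.
Qed.

Lemma opnorm_ge0 n (x : 'M[R[i]]_n) : 0 <= opnorm x.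
Proof.
rewrite (le_trans _ (@opnorm_ub1 _ x 0 _)) ?l2norm_ge0//.
by rewrite l2norm0 ler01.
Qed.

Lemma opnorm_ub n (x : 'M[R[i]]_n) (v : 'cV[R[i]]_n) :
  l2norm (x *m v) <= opnorm x * l2norm v.
Proof.
have [/l2norm_eq0 ->|v0] := eqVneq (l2norm v) 0.
  by rewrite mulmx0 !l2norm0 mulr0.
have vgt0 : 0 < l2norm v by rewrite lt_neqAle eq_sym v0 l2norm_ge0.
pose c := (l2norm v)^-1; have nv : normc (c%:C%C) = c.
  by apply: complexI; rewrite -normE ger0_norm// lecR invr_ge0 l2norm_ge0.
rewrite -ler_pdivrMr// mulrC -/c -nv -l2normZ scalemxAr opnorm_ub1//.
by rewrite l2normZ nv mulVf.
Qed.

Lemma opnorm_entry n (x : 'M[R[i]]_n) j k : normc (x j k) <= opnorm x.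
Proof.
have d1 : l2norm (delta_mx k ord0 : 'cV[R[i]]_n) <= 1.
  apply: l2norm_le => //; rewrite (bigD1 k)//= big1 => [|h /negPf hk].
    by rewrite mxE !eqxx addr0 Normc.normc1 expr1n.
  by rewrite mxE hk Normc.normc0 expr0n.
apply: le_trans (opnorm_ub1 x d1); rewrite -colE.
by apply: le_trans (normc_entry _ j); rewrite mxE.
Qed.

Lemma opnorm_le_sum n (x : 'M[R[i]]_n) : opnorm x <= \sum_j \sum_k normc (x j k).
Proof.
apply: opnorm_le => v v1; rewrite (le_trans (l2norm_mulmx _ _))//.
by rewrite ler_piMr ?sum_normc_ge0.
Qed.

Lemma opnormD n (x y : 'M[R[i]]_n) : opnorm (x + y) <= opnorm x + opnorm y.
Proof.
apply: opnorm_le => v v1; rewrite mulmxDl (le_trans (l2normD _ _))//.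
by rewrite lerD// opnorm_ub1.
Qed.

Lemma opnormZ_le n (k : R[i]) (x : 'M[R[i]]_n) :
  opnorm (k *: x) <= normc k * opnorm x.
Proof.
apply: opnorm_le => v v1.
by rewrite -scalemxAl l2normZ ler_wpM2l ?normc_ge0 ?opnorm_ub1.
Qed.

Lemma opnormM n (x y : 'M[R[i]]_n) : opnorm (x *m y) <= opnorm x * opnorm y.
Proof.
apply: opnorm_le => v v1; rewrite -mulmxA (le_trans (opnorm_ub _ _))//.
by rewrite ler_wpM2l ?opnorm_ge0 ?opnorm_ub1.
Qed.

Lemma adjointK n m : cancel (@adjoint n m) (@adjoint m n).
Proof. by move=> x; apply/matrixP => j k; rewrite !mxE conjCK. Qed.

Lemma adjointD n m (x y : 'M[R[i]]_(n, m)) : adjoint (x + y) = adjoint x + adjoint y.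
Proof. by apply/matrixP => j k; rewrite !mxE rmorphD. Qed.

Lemma adjointZ n m (k : R[i]) (x : 'M[R[i]]_(n, m)) :
  adjoint (k *: x) = Num.conj k *: adjoint x.
Proof. by apply/matrixP => j l; rewrite !mxE rmorphM. Qed.

Lemma adjointM n m p (x : 'M[R[i]]_(n, m)) (y : 'M[R[i]]_(m, p)) :
  adjoint (x *m y) = adjoint y *m adjoint x.
Proof. by rewrite /adjoint map_mxM trmx_mul. Qed.

Lemma opnorm_cstar_ge n (x : 'M[R[i]]_n) : opnorm x ^+ 2 <= opnorm (adjoint x *m x).
Proof.
set M := opnorm (adjoint x *m x); have M0 : 0 <= M by exact: opnorm_ge0.
rewrite -[M]sqr_sqrtr// ler_pXn2r ?nnegrE ?opnorm_ge0 ?sqrtr_ge0//.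
apply: opnorm_le => v v1; apply: l2norm_le; first exact: sqrtr_ge0.
rewrite sqr_sqrtr//.
have -> : \sum_j normc ((x *m v) j ord0) ^+ 2 =
    normc ((adjoint v *m (adjoint x *m x *m v)) ord0 ord0).
  rewrite -mulmxA [adjoint v *m _]mulmxA -adjointM [in RHS]mxE.
  apply: complexI; rewrite -normE ger0_norm; last first.
    by apply: sumr_ge0 => j _; rewrite !mxE mulrC mul_conjC_ge0.
  rewrite rmorph_sum /=; apply: eq_bigr => j _.
  by rewrite rmorphXn /= -normE normCK !mxE mulrC.
rewrite mxE (le_trans (normc_sum _ _))//.
apply: (@le_trans _ _ (l2norm v * l2norm (adjoint x *m x *m v))).
  rewrite (le_trans _ (le_l2norm _ _))// ler_sum// => j _.
  by rewrite Normc.normcM !mxE normc_conj.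
rewrite -[leRHS]mul1r ler_pM ?l2norm_ge0//; exact: opnorm_ub1.
Qed.

Lemma opnorm_adjoint_le n (x : 'M[R[i]]_n) : opnorm x <= opnorm (adjoint x).
Proof.
have [->|x0] := eqVneq (opnorm x) 0; first exact: opnorm_ge0.
have xgt0 : 0 < opnorm x by rewrite lt_neqAle eq_sym x0 opnorm_ge0.
by rewrite -(ler_pM2r xgt0) -expr2 (le_trans (opnorm_cstar_ge x))// opnormM.
Qed.

Lemma opnorm_cstar n (x : 'M[R[i]]_n) : opnorm (adjoint x *m x) = opnorm x ^+ 2.
Proof.
apply/eqP; rewrite eq_le opnorm_cstar_ge andbT (le_trans (opnormM _ _))//.
rewrite expr2 ler_wpM2r ?opnorm_ge0//.
by rewrite -{2}(adjointK x) opnorm_adjoint_le.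
Qed.

End OperatorNorm.

(** The direct sum of the matrix algebras [M_(r k)], [k : I]. *)
Definition fdalg (R : realType) (I : finType) (r : I -> nat) :=
  forall k : I, 'M[R[i]]_(r k).

Section FiniteDimensional.
Variables (R : realType) (I : finType) (r : I -> nat).
Notation F := (fdalg R r).
Implicit Types x y z : F.

HB.instance Definition _ := gen_eqMixin F.
HB.instance Definition _ := gen_choiceMixin F.

Definition fd_add x y : F := fun k => x k + y k.
Definition fd_opp x : F := fun k => - x k.
Definition fd_scale (a : R[i]) x : F := fun k => a *: x k.
Definition fd_mul x y : F := fun k => x k *m y k.
Definition fd_star x : F := fun k => adjoint (x k).
Definition fd_norm x : R := \big[Num.max/0]_k opnorm (x k).

Lemma fd_eq x y : (forall k, x k = y k) -> x = y.
Proof. exact: functional_extensionality_dep. Qed.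

Lemma fd_addA : associative fd_add.
Proof. by move=> x y z; apply: fd_eq => k; rewrite /fd_add addrA. Qed.
Lemma fd_addC : commutative fd_add.
Proof. by move=> x y; apply: fd_eq => k; rewrite /fd_add addrC. Qed.
Lemma fd_add0 : left_id (fun=> 0) fd_add.
Proof. by move=> x; apply: fd_eq => k; rewrite /fd_add add0r. Qed.
Lemma fd_addN : left_inverse (fun=> 0) fd_opp fd_add.
Proof. by move=> x; apply: fd_eq => k; rewrite /fd_add addNr. Qed.

HB.instance Definition _ :=
  GRing.isZmodule.Build F fd_addA fd_addC fd_add0 fd_addN.

Lemma fd_scaleA a b x : fd_scale a (fd_scale b x) = fd_scale (a * b) x.
Proof. by apply: fd_eq => k; rewrite /fd_scale scalerA. Qed.
Lemma fd_scale1 : left_id 1 fd_scale.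
Proof. by move=> x; apply: fd_eq => k; rewrite /fd_scale scale1r. Qed.
Lemma fd_scaleDr : right_distributive fd_scale +%R.
Proof. by move=> a x y; apply: fd_eq => k; rewrite /fd_scale scalerDr. Qed.
Lemma fd_scaleDl x : {morph fd_scale^~ x : a b / a + b}.
Proof. by move=> a b; apply: fd_eq => k; rewrite /fd_scale scalerDl. Qed.

HB.instance Definition _ := GRing.Zmodule_isLmodule.Build R[i] F
  fd_scaleA fd_scale1 fd_scaleDr fd_scaleDl.

Lemma fd_norm_ub x k : opnorm (x k) <= fd_norm x.
Proof. exact: le_bigmax. Qed.

Lemma fd_norm_ge0 x : 0 <= fd_norm x.
Proof. exact: bigmax_ge_id. Qed.

Lemma fd_norm_le x (M : R) :
  0 <= M -> (forall k, opnorm (x k) <= M) -> fd_norm x <= M.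
Proof. by move=> M0 xM; apply: bigmax_le. Qed.

Lemma fd_normD x y :
  (fd_norm (x + y))%:C%C <= (fd_norm x)%:C%C + (fd_norm y)%:C%C :> R[i].
Proof.
rewrite -rmorphD /= lecR fd_norm_le ?addr_ge0 ?fd_norm_ge0// => k.
by rewrite (le_trans (opnormD _ _))// lerD ?fd_norm_ub.
Qed.

Lemma fd_normZ (a : R[i]) x :
  (fd_norm (a *: x))%:C%C = `|a| * (fd_norm x)%:C%C :> R[i].
Proof.
rewrite normE -rmorphM /=; congr (_%:C)%C.
have le b y : fd_norm (b *: y) <= normc b * fd_norm y.
  rewrite fd_norm_le ?mulr_ge0 ?normc_ge0 ?fd_norm_ge0// => k.
  by rewrite (le_trans (opnormZ_le _ _))// ler_wpM2l ?normc_ge0 ?fd_norm_ub.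
apply/eqP; rewrite eq_le le /=; have [->|a0] := eqVneq a 0.
  by rewrite Normc.normc0 mul0r fd_norm_ge0.
have na0 : 0 < normc a by rewrite -ltcR -normE normr_gt0.
rewrite -ler_pdivlMl// -Normc.normcV (le_trans _ (le _ _))//.
by rewrite scalerA mulVf// scale1r.
Qed.

Lemma fd_norm0_eq0 x : (fd_norm x)%:C%C = 0 :> R[i] -> x = 0.
Proof.
move=> /(@complexI _ _ 0) x0; apply: fd_eq => k; apply/matrixP => j l.
rewrite mxE; apply: Normc.eq0_normc; apply/eqP.
by rewrite eq_le normc_ge0 -x0 (le_trans (opnorm_entry _ _ _))// fd_norm_ub.
Qed.

HB.instance Definition _ := Lmodule_isNormed.Build R[i] F
  fd_normD fd_normZ fd_norm0_eq0.

Lemma fd_normE x : `|x| = (fd_norm x)%:C%C. Proof. by []. Qed.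

Lemma fd_complete (G : set_system F) : ProperFilter G -> cauchy G -> cvg G.
Proof.
move=> GF Gc.
have [|l Gl] := @cauchy_pointwise R F {k : I & ('I_(r k) * 'I_(r k))%type}
    (fun t x => x (tag t) (tagged t).1 (tagged t).2) G _ GF Gc.
  move=> [k [j l]] x y /=; rewrite fd_normE lecR.
  have -> : x k j l - y k j l = (x - y) k j l by rewrite !mxE.
  by rewrite (le_trans (opnorm_entry _ _ _))// fd_norm_ub.
pose L : F := fun k => \matrix_(j, h) l (existT _ k (j, h)).
apply/cvg_ex; exists L; apply/cvgrPdist_le => _ /gt0_complex[e e0 ->].
pose N : R := (\max_k (r k * r k))%N.+1%:R.
have N0 : 0 < N by rewrite ltr0n.
have [|A GA HA] := Gl (e / N); first by rewrite divr_gt0.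
apply: filterS GA => x Ax; rewrite fd_normE lecR fd_norm_le ?ltW// => k.
rewrite (le_trans (opnorm_le_sum _))//.
apply: (@le_trans _ _ (\sum_(j < r k) \sum_(h < r k) (e / N))).
  do 2![apply: ler_sum => ? _]; rewrite !mxE normcB.
  exact: (HA x (existT _ k (_, _))).
rewrite !sumr_const !card_ord -mulrnA -[leLHS]mulr_natr mulrAC ler_pdivrMr//.
rewrite ler_wpM2l ?ltW// ltr_nat ltnS.
by rewrite (bigD1 k) //= leq_maxl.
Qed.

HB.instance Definition _ := Uniform_isComplete.Build F fd_complete.

Lemma fd_mulA : associative fd_mul.
Proof. by move=> x y z; apply: fd_eq => k; rewrite /fd_mul mulmxA. Qed.
Lemma fd_mulDl : left_distributive fd_mul +%R.
Proof. by move=> x y z; apply: fd_eq => k; rewrite /fd_mul mulmxDl. Qed.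
Lemma fd_mulDr : right_distributive fd_mul +%R.
Proof. by move=> x y z; apply: fd_eq => k; rewrite /fd_mul mulmxDr. Qed.
Lemma fd_mulZl (a : R[i]) x y : fd_mul (a *: x) y = a *: fd_mul x y.
Proof. by apply: fd_eq => k; rewrite /fd_mul -scalemxAl. Qed.
Lemma fd_mulZr (a : R[i]) x y : fd_mul x (a *: y) = a *: fd_mul x y.
Proof. by apply: fd_eq => k; rewrite /fd_mul -scalemxAr. Qed.
Lemma fd_starK : involutive fd_star.
Proof. by move=> x; apply: fd_eq => k; rewrite /fd_star adjointK. Qed.
Lemma fd_starD : {morph fd_star : x y / x + y}.
Proof. by move=> x y; apply: fd_eq => k; rewrite /fd_star adjointD. Qed.
Lemma fd_starZ (a : R[i]) x : fd_star (a *: x) = Num.conj a *: fd_star x.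
Proof. by apply: fd_eq => k; rewrite /fd_star adjointZ. Qed.
Lemma fd_starM x y : fd_star (fd_mul x y) = fd_mul (fd_star y) (fd_star x).
Proof. by apply: fd_eq => k; rewrite /fd_star adjointM. Qed.

Lemma fd_norm_mul x y : `|fd_mul x y| <= `|x| * `|y|.
Proof.
rewrite !fd_normE -rmorphM /= lecR fd_norm_le ?mulr_ge0 ?fd_norm_ge0// => k.
by rewrite (le_trans (opnormM _ _))// ler_pM ?opnorm_ge0 ?fd_norm_ub.
Qed.

Lemma fd_norm_star x : `|fd_mul (fd_star x) x| = `|x| ^+ 2.
Proof.
rewrite !fd_normE -rmorphXn /=; congr (_%:C)%C.
apply/eqP; rewrite eq_le; apply/andP; split.
  rewrite fd_norm_le ?sqr_ge0// => k; rewrite opnorm_cstar.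
  by rewrite ler_pXn2r ?nnegrE ?opnorm_ge0 ?fd_norm_ge0 ?fd_norm_ub.
rewrite -[leRHS]sqr_sqrtr ?fd_norm_ge0//.
rewrite ler_pXn2r ?nnegrE ?fd_norm_ge0 ?sqrtr_ge0//.
rewrite fd_norm_le ?sqrtr_ge0// => k.
rewrite -(ger0_norm (opnorm_ge0 (x k))) -sqrtr_sqr ler_sqrt ?fd_norm_ge0//.
by rewrite -opnorm_cstar (fd_norm_ub (fd_mul (fd_star x) x)).
Qed.

HB.instance Definition _ :=
  CompleteNormedModule_isCStarAlgebra.Build R F
    fd_mulA fd_mulDl fd_mulDr fd_mulZl fd_mulZr
    fd_starK fd_starD fd_starZ fd_starM fd_norm_mul fd_norm_star.

End FiniteDimensional.

(** The inclusion of the partial direct sum over [[set k | P k]], extending by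
    [0] on the remaining summands. *)
Definition fd_incl (R : realType) (I : finType) (r : I -> nat) (P : pred I)
    (x : fdalg R (fun k : {k : I | P k} => r (val k))) : fdalg R r :=
  fun k => match @idP (P k) with
           | ReflectT Pk => x (exist _ k Pk)
           | ReflectF _ => 0
           end.

Section DecompositionRank.
Variable R : realType.
Implicit Types A B F : cstarAlgType R.

(** Positivity in the C*-algebra [M_k(A)], in the form [a = b^* b]. *)
Definition mx_positive A k (a : 'M[A]_k) : Prop :=
  exists b : 'M[A]_k, forall i j, a i j = \sum_l star (b l i) ** b l j.

Definition completely_positive A B (f : {linear A -> B}) : Prop :=
  forall k (a : 'M[A]_k), mx_positive a -> mx_positive (map_mx f a).

Definition contractive A B (f : A -> B) : Prop := forall x, `|f x| <= `|x|.

Definition cpc A B (f : {linear A -> B}) : Prop :=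
  completely_positive f /\ contractive f.

Definition projection A (p : A) : Prop := star p = p /\ p ** p = p.

(** For projections [q] and [p], [q <= p] is equivalent to [q ** p = q]. *)
Definition minimal_projection A (p : A) : Prop :=
  [/\ projection p, p != 0 &
      forall q, projection q -> q ** p = q -> q = 0 \/ q = p].

Definition strict_order_zero F A (f : F -> A) : Prop :=
  forall e e' : F, minimal_projection e -> minimal_projection e' ->
    e ** e' = 0 -> f e ** f e' = 0.

(** The decomposition of [I] is given by [c], with parts
    [[set k | c k == j]] (possibly empty). *)
Definition n_decomposable (I : finType) (r : I -> nat) A (n : nat)
    (f : fdalg R r -> A) : Prop :=
  exists c : I -> 'I_n.+1, forall j : 'I_n.+1,
    strict_order_zero (f \o @fd_incl R I r (fun k => c k == j)).

Definition cp_approximation A (m : nat) (b : 'I_m -> A) (e : R)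
    (s : nat) (r : 'I_s -> nat)
    (psi : {linear A -> fdalg R r}) (phi : {linear fdalg R r -> A}) : Prop :=
  [/\ forall i, (0 < r i)%N, cpc psi, cpc phi &
      forall i, `|phi (psi (b i)) - b i| < e%:C%C].

Definition decomposition_rank_le A (n : nat) : Prop :=
  forall (m : nat) (b : 'I_m -> A) (e : R), 0 < e ->
    exists (s : nat) (r : 'I_s -> nat)
      (psi : {linear A -> fdalg R r}) (phi : {linear fdalg R r -> A}),
      cp_approximation b e psi phi /\ n_decomposable n phi.

End DecompositionRank.

(** The least [n] satisfying [P], with [None] standing for infinity. *)
Definition least (P : nat -> Prop) : option nat :=
  if pselect (exists n, `[< P n >]) is left exP then Some (ex_minn exP)
  else None.

Definition decomposition_rank (R : realType) (A : cstarAlgType R) : option nat :=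
  least (decomposition_rank_le A).

Definition order_le (X J : Type) (V : J -> set X) (n : nat) : Prop :=
  forall l : 'I_n.+2 -> J, injective l -> \bigcap_i V (l i) = set0.

Definition covering_dim_le (X : topologicalType) (n : nat) : Prop :=
  forall (I : finType) (U : I -> set X),
    (forall i, open (U i)) -> \bigcup_i U i = setT ->
    exists (J : Type) (V : J -> set X),
      [/\ forall j, open (V j), \bigcup_j V j = setT,
          forall j, exists i, V j `<=` U i & order_le V n].

Definition covering_dim (X : topologicalType) : option nat :=
  least (covering_dim_le X).

(* Main.v *)
Require Import Defs.
From HB Require Import structures.
From mathcomp Require Import all_boot all_order all_algebra finmap.
From mathcomp Require Import all_classical all_reals all_analysis.
From mathcomp Require Import complex ring lra.

Set Implicit Arguments.
Unset Strict Implicit.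
Unset Printing Implicit Defensive.

Import Order.TTheory GRing.Theory Num.Theory numFieldNormedType.Exports.

Local Open Scope classical_set_scope.
Local Open Scope ring_scope.

(** The two inequalities match conditions "dimension at most n" one by one.

    If dim X <= n, refine a finite cover on which finitely many given functions
    oscillate little by a cover of order at most n, and take a partition of unity
    subordinate to the open stars of its barycentric subdivision: the stars of
    the faces with j + 1 vertices are pairwise disjoint, so the number of vertices
    is an (n+1)-colouring. Evaluating at points of the stars and recombining with
    the partition of unity gives the approximation. Complete positivity of the
    recombination into C0(X) amounts to a continuous square root for pointwise
    positive matrices over C0(X).

    Conversely, an order zero map into a commutative algebra kills all matrix
    blocks of size at least 2, so an approximation (psi, phi) is a combination
    of scalars psi(f)_k with weights u_k = phi(e_k) >= 0, at most n + 1 of which are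
    nonzero at any point. If phi psi almost fixes both h and h^2, then
    [sum_k u_k(x) (psi(h)_k - h(x))^2] is small, so h is nearly constant on the set
    where u_k is bounded below. These sets refine any given finite cover of a compact
    set with order at most n, and the countable sum theorem finishes the proof. *)

(** * Normality, shrinking and the countable sum theorem *)

Section Topology.
Context {X : topologicalType}.
Implicit Types (x : X) (n : nat).

Lemma locally_compact_open_nbhs x (U : set X) :
  locally_compact [set: X] -> hausdorff_space X -> open U -> U x ->
  exists W, [/\ open W, W x, closure W `<=` U & compact (closure W)].
Proof.
move=> lX hX oU Ux; have [V Vx [cV clV]] := lX x I.
have {}Vx : nbhs x V.
  apply: (@filterS _ (nbhs x) _ (fun y => setT y -> V y)) => [y|]; last exact: Vx.
  by apply.
have UVx : nbhs x (U `&` V).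
  apply: filterI; [exact: open_nbhs_nbhs|exact: Vx].
have [A Ax AUV] := compact_regular hX cV Vx UVx.
have [AU AV] : closure A `<=` U /\ closure A `<=` V by rewrite -subsetI.
have sA := closureS (@interior_subset _ A).
exists A°; split; [exact: open_interior|exact: Ax|exact: subset_trans AU|].
apply: subclosed_compact cV _; first exact: closed_closure.
exact: subset_trans AV.
Qed.

Lemma second_countable_seq : @second_countable X ->
  exists b : nat -> set X, (forall n, open (b n)) /\
    forall x U, open U -> U x -> exists n, b n x /\ b n `<=` U.
Proof.
move=> [B cB [oB nB]]; have [B0|[f]] := pfcard_geP cB.
  (* An empty basis forces [X] to be empty. *)
  exists (fun=> set0); split=> [_|x U oU Ux]; first exact: open0.
  have [V [+ _] _] := nB x U (open_nbhs_nbhs (conj oU Ux)).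
  by rewrite B0.
exists f; split=> [n|x U oU Ux]; first by apply/oB/funS.
have [V [BV Vx] VU] := nB x U (open_nbhs_nbhs (conj oU Ux)).
by have [n _ fn] := @surj _ _ _ _ f _ BV; exists n; rewrite fn.
Qed.

Lemma open_setD_bigcup_closure (A : set X) (F : nat -> set X) n :
  open A -> open (A `&` ~` \bigcup_(k in `I_n) closure (F k)).
Proof.
move=> oA; apply: openI => //; apply: closed_openC; apply: closed_bigcup => //.
by move=> k _; exact: closed_closure.
Qed.

(* Tychonoff's argument: from the basic sets whose closure misses [B], resp. [A],
   remove the closures of the earlier sets of the other family. *)
Lemma second_countable_locally_compact_normal (R : realType) :
  @second_countable X -> locally_compact [set: X] -> hausdorff_space X ->
  normal_space X.
Proof.
move=> /second_countable_seq[b [ob Hb]] lX hX.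
apply/(@normal_openP R) => A B clA clB AB0.
pose F (C : set X) n := if `[< closure (b n) `&` C = set0 >] then b n else set0.
have oF C n : open (F C n) by rewrite /F; case: ifP => _ //; exact: open0.
have F0 C n : closure (F C n) `&` C = set0.
  rewrite /F; case: ifPn => [/asboolP//|_].
  by rewrite closure0 set0I.
have FC C D x : closed C -> D `&` C = set0 -> D x -> exists n, F C n x.
  move=> clC DC Dx.
  have [||W [oW Wx WC _]] := @locally_compact_open_nbhs x (~` C) lX hX.
  - exact: closed_openC.
  - by move=> Cx; have : (D `&` C) x by []; rewrite DC.
  have [n [bx bW]] := Hb _ _ oW Wx; exists n; rewrite /F asboolT//.
  by apply/disjoints_subset; exact: subset_trans (closureS bW) WC.
exists (\bigcup_n (F B n `&` ~` \bigcup_(k in `I_n.+1) closure (F A k))).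
exists (\bigcup_n (F A n `&` ~` \bigcup_(k in `I_n.+1) closure (F B k))).
split.
- by apply: bigcup_open => n _; exact: open_setD_bigcup_closure.
- by apply: bigcup_open => n _; exact: open_setD_bigcup_closure.
- move=> x Ax; have [n Fx] := FC B A x clB AB0 Ax.
  exists n => //; split => // -[k _ Fk].
  by have : (closure (F A k) `&` A) x by []; rewrite F0.
- rewrite setIC in AB0; move=> x Bx; have [n Fx] := FC A B x clA AB0 Bx.
  exists n => //; split => // -[k _ Fk].
  by have : (closure (F B k) `&` B) x by []; rewrite F0.
rewrite -subset0 => x [[n _ [Fn nn]] [m _ [Fm nm]]].
(* The removed unions include the index itself, so the tie [n = m] falls under the first case. *)
have [nlem|mltn] := leqP n m.
- by apply: nm; exists n => //=; exact: subset_closure.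
- by apply: nn; exists m => /=; [rewrite ltnS ltnW|exact: subset_closure].
Qed.

(** Each point has a relatively compact neighbourhood and a basic set inside it, so the basic sets
    with compact closure already cover. *)
Lemma sigma_compact :
  @second_countable X -> locally_compact [set: X] -> hausdorff_space X ->
  exists K : nat -> set X, (forall n, compact (K n)) /\ \bigcup_n K n = setT.
Proof.
move=> /second_countable_seq[b [ob Hb]] lX hX.
exists (fun n => if `[< compact (closure (b n)) >] then closure (b n) else set0).
split=> [n|]; first by case: ifPn => [/asboolP//|_]; exact: compact0.
apply/seteqP; split=> // x _.
have [W [oW Wx _ cW]] := locally_compact_open_nbhs lX hX openT (I : setT x).
have [n [bx bW]] := Hb _ _ oW Wx; exists n => //; rewrite asboolT.
  exact: subset_closure.
by apply: subclosed_compact cW (closureS bW); exact: closed_closure.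
Qed.

Lemma normal_closed_open (C U : set X) : normal_space X -> closed C -> open U ->
  C `<=` U -> exists W, [/\ open W, C `<=` W & closure W `<=` U].
Proof.
move=> nX clC oU CU; have [|N + NU] := nX C clC U.
  by apply/set_nbhsP; exists U; split.
move=> /set_nbhsP[W [oW CW WN]]; exists W; split=> //.
exact: subset_trans (closureS WN) NU.
Qed.

(** Members are shrunk one at a time: the points missed by all the others form a closed subset of
    [V j], and normality fits an open set and its closure between the two. *)
Lemma shrinking (I : finType) (U : I -> set X) : normal_space X ->
  (forall i, open (U i)) -> \bigcup_i U i = setT ->
  exists V : I -> set X, [/\ forall i, open (V i),
    forall i, closure (V i) `<=` U i & \bigcup_i V i = setT].
Proof.
move=> nX oU cU.
suff H (s : seq I) : exists V : I -> set X, [/\ forall i, open (V i),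
    forall i, V i `<=` U i, forall i, i \in s -> closure (V i) `<=` U i
    & \bigcup_i V i = setT].
  have [V [oV _ VU cV]] := H (enum I); exists V; split=> // i.
  by apply: VU; rewrite mem_enum.
elim: s => [|j s [V [oV VU VsU cV]]]; first by exists U; split=> // i x.
have [|||W [oW CW WV]] :=
    @normal_closed_open (~` \bigcup_(i in [set i | i != j]) V i) (V j) nX.
- by apply: open_closedC; apply: bigcup_open => i _; exact: oV.
- exact: oV.
- move=> x /= nVx; have : setT x by [].
  rewrite -cV => -[i _ Vix]; have [<-//|ij] := eqVneq i j.
  by exfalso; apply: nVx; exists i.
exists (fun i => if i == j then W else V i); split.
- by move=> i; case: ifP.
- move=> i; case: eqP => [->|_]; last exact: VU.
  by apply: subset_trans (VU j); apply: subset_trans WV; exact: subset_closure.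
- move=> i; rewrite inE; case: eqP => [-> _|_ /VsU//].
  exact: subset_trans (VU j).
apply/seteqP; split=> // x _.
have [[i /= ij Vix]|nVx] := pselect ((\bigcup_(i in [set i | i != j]) V i) x).
  by exists i => //; rewrite (negPf ij).
by exists j; rewrite ?eqxx//; exact: CW.
Qed.

(* Swelling is shrinking of the complementary open cover [~` F (l k)], for each
   injective [l]. *)
Lemma swelling (I : finType) (F U : I -> set X) n : normal_space X ->
  (forall i, closed (F i)) -> (forall i, open (U i)) ->
  (forall i, F i `<=` U i) -> order_le F n ->
  exists V : I -> set X, [/\ forall i, open (V i), forall i, F i `<=` V i,
    forall i, V i `<=` U i & order_le V n].
Proof.
move=> nX clF oU FU Fn.
have HG (l : {ffun 'I_n.+2 -> I}) : exists G : 'I_n.+2 -> set X,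
    injective l -> (forall k, closure (G k) `<=` ~` F (l k)) /\ \bigcup_k G k = setT.
  have [il|nil] := pselect (injective l); last by exists (fun=> set0).
  have [||G [_ GF cG]] := @shrinking 'I_n.+2 (fun k => ~` F (l k)) nX.
  - by move=> k; exact: closed_openC.
  - apply/seteqP; split=> // x _; apply: contrapT => nx.
    have : (\bigcap_k F (l k)) x.
      by move=> k _; apply: contrapT => Fx; apply: nx; exists k.
    by rewrite Fn.
  by exists G.
pose G l := projT1 (cid (HG l)).
(* The set at [i] will avoid [closure (G l k)] whenever [l k = i]. For fixed injective [l] the
   [G l k] cover, so no point survives at every [l k]. As [l] ranges over a finite type, the removed
   set is closed. *)
pose P i := [set t : {ffun 'I_n.+2 -> I} * 'I_n.+2 | injective t.1 /\ t.1 t.2 = i].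
exists (fun i => U i `&` ~` \bigcup_(t in P i) closure (G t.1 t.2)); split.
- move=> i; apply: openI => //; apply: closed_openC; apply: closed_bigcup.
    exact: finite_finset.
  by move=> t _; exact: closed_closure.
- move=> i x Fx; split; first exact: FU.
  move=> [[l k] [/= il lk] cl]; have [/(_ k x cl)] := projT2 (cid (HG l)) il.
  by rewrite lk.
- by move=> i x [].
move=> l il; rewrite -subset0 => x Vx.
have il' : injective [ffun k => l k] by move=> j k; rewrite !ffunE => /il.
have [_ cG] := projT2 (cid (HG [ffun k => l k])) il'.
have : setT x by []; rewrite -cG => -[k _ Gx].
have [_ []] := Vx k Logic.I; exists ([ffun k => l k], k) => /=.
  by split => //=; rewrite ffunE.
exact: subset_closure.
Qed.

(* Shrink the cover successively, achieving order at most [n] on [K m] at stage [m].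
   The intersections of the stages form a closed cover of order at most [n], which
   is then swollen. *)
Lemma covering_dim_le_sum n (K : nat -> set X) : normal_space X ->
  (forall m, closed (K m)) -> \bigcup_m K m = setT ->
  (forall m (I : finType) (U : I -> set X), (forall i, open (U i)) ->
    K m `<=` \bigcup_i U i ->
    exists W : I -> set X, [/\ forall i, open (W i), forall i, W i `<=` U i,
      K m `<=` \bigcup_i W i & order_le W n]) ->
  covering_dim_le X n.
Proof.
move=> nX clK cK HK I U oU cU.
pose S := {U : I -> set X | (forall i, open (U i)) /\ \bigcup_i U i = setT}.
have step m (A : S) : exists B : S, (forall i, closure (sval B i) `<=` sval A i) /\
    forall l : 'I_n.+2 -> I, injective l -> K m `&` \bigcap_k (sval B (l k)) = set0.
  case: A => A [oA cA] /=.
  have [|W [oW WA cW Wn]] := HK m I A oA; first by rewrite cA.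
  (* This cover is [W] on [K m] and [A] elsewhere, so a shrinking of it has order at most [n] on
     [K m]. *)
  have [||B [oB BW cB]] := @shrinking I (fun i => W i `|` (A i `&` ~` K m)) nX.
  - move=> i; apply: openU => //; apply: openI => //; exact: closed_openC.
  - apply/seteqP; split=> // x _.
    have [/cW[i _ Wx]|nKx] := pselect (K m x); first by exists i => //; left.
    by have : setT x by []; rewrite -cA => -[i _ Ax]; exists i => //; right.
  exists (exist _ B (conj oB cB)); split=> /= [i|l il].
    by apply: subset_trans (BW i) _ => x [/WA|[]].
  rewrite -subset0 => x [Kx Bx].
  suff : (\bigcap_k W (l k)) x by rewrite Wn.
  by move=> k _; have [//|[]] := BW (l k) x (subset_closure (Bx k Logic.I)).
pose nxt m A := projT1 (cid (step m A)).
pose fix V m : S := if m is m'.+1 then nxt m' (V m') else exist _ U (conj oU cU).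
have clV m i : closure (sval (V m.+1) i) `<=` sval (V m) i.
  by have [+ _] := projT2 (cid (step m (V m))); exact.
have decV m p i : (m <= p)%N -> sval (V p) i `<=` sval (V m) i.
  elim: p => [|p IH]; first by rewrite leqn0 => /eqP ->.
  rewrite leq_eqVlt => /orP[/eqP ->//|/IH]; apply: subset_trans => x.
  by move=> /subset_closure /clV.
pose F i := \bigcap_m sval (V m) i.
have clF i : closed (F i).
  rewrite (_ : F i = \bigcap_m closure (sval (V m.+1) i)).
    by apply: closed_bigI => m _; exact: closed_closure.
  apply/seteqP; split=> x Fx m _; first exact/subset_closure/Fx.
  exact/clV/Fx.
have Fn : order_le F n.
  move=> l il; rewrite -subset0 => x Fx.
  have : setT x by []; rewrite -cK => -[m _ Kx].
  have [_ /(_ l il)] := projT2 (cid (step m (V m))).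
  by rewrite -subset0 => /(_ x); apply; split => // k _; exact: (Fx k Logic.I m.+1).
have cF : \bigcup_i F i = setT.
  apply/seteqP; split=> // x _; apply: contrapT => nFx.
  have Hm i : exists m, ~ sval (V m) i x.
    apply: contrapT => /forallNP nm; apply: nFx; exists i => // m _.
    exact: contrapT (nm m).
  (* Stages decrease, so at the largest of these finitely many stages no member contains [x],
     although the members cover. *)
  pose mm i := projT1 (cid (Hm i)).
  have [_ cV] := svalP (V (\max_i mm i)).
  have : setT x by []; rewrite -cV => -[i _ Vx].
  have := projT2 (cid (Hm i)); apply; apply: decV Vx.
  exact: (@leq_bigmax _ mm).
have [|W [oW FW WU Wn]] := swelling nX clF oU _ Fn; first by move=> i x /(_ 0%N Logic.I).
exists I, W; split=> //; last by move=> i; exists i.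
by apply/seteqP; split=> // x _; have : setT x by []; rewrite -cF => -[i _ /FW]; exists i.
Qed.

(** A common point of the unions lies in one member from each, and [a] keeps these members distinct.
    This turns a refinement with any index type into one indexed by the refined cover; members sent
    to [None] are dropped. *)
Lemma order_le_merge (J I : Type) (V : J -> set X) (a : J -> option I) n :
  order_le V n -> order_le (fun i => \bigcup_(j in [set j | a j = Some i]) V j) n.
Proof.
move=> Vn l il; rewrite -subset0 => x Vx.
pose j k := projT1 (cid2 (Vx k Logic.I)).
have aj k : a (j k) = Some (l k) by exact: (projT2 (cid2 (Vx k Logic.I))).1.
suff : (\bigcap_k V (j k)) x by rewrite Vn// => k k' /(congr1 a); rewrite !aj => -[/il].
by move=> k _; exact: (projT2 (cid2 (Vx k Logic.I))).2.
Qed.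

End Topology.

(* [compact_cover] is stated for pointed spaces only. *)
Lemma compact_cover_compact (X : topologicalType) (K : set X) :
  compact K -> cover_compact K.
Proof.
have [[x _]|K0] := pselect (K !=set0); last first.
  move=> _ I D f _ _; exists fset0 => [i|x Kx]; first by rewrite inE.
  by exfalso; apply: K0; exists x.
pose pX : ptopologicalType := HB.pack X (isPointed.Build X x).
by move=> cK; have := cK : @compact pX K; rewrite compact_cover.
Qed.

(** * Bump functions on locally compact Hausdorff spaces *)

Section Bumps.
Variables (R : realType) (X : topologicalType).
Hypothesis X_lc : locally_compact [set: X].
Hypothesis X_hausdorff : hausdorff_space X.

Lemma bump (x : X) (U : set X) : open U -> U x ->
  exists f : X -> R, [/\ continuous f, forall y, 0 <= f y <= 1, f x = 1 &
    exists2 C, compact C /\ C `<=` U & forall y, ~ C y -> f y = 0].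
Proof.
move=> oU Ux.
have [W [oW Wx WU cW]] := locally_compact_open_nbhs X_lc X_hausdorff oU Ux.
have /(@uniform_separatorP _ R)[f [cf f01 fx fW]] :
    uniform_separator [set x] (~` W).
  apply: (@locally_compact_completely_regular _ R X_lc X_hausdorff).
    exact: open_closedC.
  by apply.
exists (fun y => 1 - f y); split.
- by move=> y; apply: cvgB; [exact: cvg_cst|exact: cf].
- move=> y; have : `[0, 1]%classic (f y) by apply: f01; exists y.
  by rewrite /= in_itv /= => /andP[f0 f1]; rewrite subr_ge0 f1 lerBlDr lerDl.
- by have /= -> : [set 0] (f x); [apply: fx; exists x|rewrite subr0].
exists (closure W) => // y nW.
have /= -> : [set 1] (f y); last by rewrite subrr.
by apply: fW; exists y => // Wy; apply: nW; exact: subset_closure.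
Qed.

Lemma continuous_sum (I : Type) (s : seq I) (P : pred I) (f : I -> X -> R) :
  (forall i, P i -> continuous (f i)) ->
  continuous (fun x => \sum_(i <- s | P i) f i x).
Proof.
move=> cf x; elim: s => [|i s IH].
  by under eq_fun do rewrite big_nil; exact: cvg_cst.
have [Pi|nPi] := boolP (P i); under eq_fun do rewrite big_cons.
  by rewrite Pi; apply: cvgD => //; exact: cf.
by rewrite (negPf nPi).
Qed.

Lemma continuous_prod (I : Type) (s : seq I) (P : pred I) (f : I -> X -> R) :
  (forall i, P i -> continuous (f i)) ->
  continuous (fun x => \prod_(i <- s | P i) f i x).
Proof.
move=> cf x; elim: s => [|i s IH].
  by under eq_fun do rewrite big_nil; exact: cvg_cst.
have [Pi|nPi] := boolP (P i); under eq_fun do rewrite big_cons.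
  by rewrite Pi; apply: cvgM => //; exact: cf.
by rewrite (negPf nPi).
Qed.

(** By compactness finitely many bumps suffice for one of them to exceed 1/2 at each point of [K].
    Summing those below the same [U i], doubling and cutting off at 1 yields the value 1 on [K], not
    just a positive one. *)
Lemma bump_family (I : finType) (K : set X) (U : I -> set X) :
  compact K -> (forall i, open (U i)) -> K `<=` \bigcup_i U i ->
  exists h : I -> X -> R, [/\ forall i, continuous (h i),
    forall i x, 0 <= h i x <= 1, forall x, K x -> exists i, h i x = 1 &
    exists2 C : I -> set X, forall i, compact (C i) /\ C i `<=` U i &
      forall i x, ~ C i x -> h i x = 0].
Proof.
move=> cK oU KU.
pose A : Type := (I * (X -> R) * set X)%type.
pose T : choiceType := {classic A}.
pose fn (t : A) := t.1.2; pose supp (t : A) := t.2.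
pose D : set T := [set t : A | [/\ continuous t.1.2, forall y, 0 <= t.1.2 y <= 1,
  compact t.2, t.2 `<=` U t.1.1 & forall y, ~ t.2 y -> t.1.2 y = 0]].
case: (@compact_cover_compact _ K cK T D (fun t : A => [set y | 1 / 2 < t.1.2 y]))
  => [t [ct _ _ _ _]|x Kx|D' D'D cD'].
- by apply: (@open_comp _ _ t.1.2 [set r | 1 / 2 < r]) => [y _|];
    [exact: ct|exact: open_gt].
- have [i _ Uix] := KU x Kx.
  have [f [cf f01 fx [C [cC CU] C0]]] := bump (oU i) Uix.
  by exists (i, f, C) => //=; rewrite fx; lra.
have {}D'D (t : A) : (t : T) \in D' -> D t by move=> /D'D; rewrite inE.
pose P i (t : A) := ((t : T) \in D') && (t.1.1 == i).
have PD i (t : A) : P i t -> D t by move=> /andP[/D'D].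
have S0 i x : 0 <= \sum_(t <- D' | P i t) fn t x.
  by apply: sumr_ge0 => t /PD[_ /(_ x)/andP[]].
exists (fun i x => Num.min 1 (2 * \sum_(t <- D' | P i t) fn t x)); split.
- move=> i x; apply: (@continuous_min _ _ (fun=> 1)
      (fun x => 2 * \sum_(t <- D' | P i t) fn t x)); first exact: cvg_cst.
  apply: cvgM; first exact: cvg_cst.
  by apply: continuous_sum => t /PD[].
- by move=> i x; rewrite le_min ler01 mulr_ge0 ?ler0n ?S0//= ge_min lexx.
- move=> x /cD'[t /= tD' tx]; exists t.1.1; apply/min_idPl.
  rewrite (big_rem t)//= /P tD' eqxx /=.
  set S := \sum_(_ <- _ | _) _.
  suff : 0 <= S by move: tx; rewrite /fn; lra.
  apply: sumr_ge0 => t' /andP[t'D' _].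
  by have [_ /(_ x)/andP[]] := D'D _ t'D'.
exists (fun i => \big[setU/set0]_(t <- D' | P i t) supp t) => [i|i x].
  split; first by apply: bigsetU_compact => t /PD[].
  elim/big_ind : _ => [//|B B' BU BU' x [/BU|/BU']//|t /andP[tD' /eqP <-]].
  by have [] := D'D _ tD'.
rewrite -bigcup_seq_cond => nC; rewrite big1 ?mulr0; first by apply/min_idPr.
move=> t Pt; rewrite /fn; have [_ _ _ _ ->//] := PD _ _ Pt.
by move=> tx; apply: nC; exists t => //=; case/andP: (Pt) => ->.
Qed.

End Bumps.

(** * Square roots of positive matrices of functions *)

Lemma lt_inv_succ (R : realType) (C e : R) : 0 < e -> exists n, C / n.+2%:R < e.
Proof.
move=> e0; have [n nP] : exists n, C / e < n%:R.
  exists (Num.bound `|C / e|); rewrite (le_lt_trans (ler_norm _))//.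
  by rewrite archi_boundP.
exists n; rewrite ltr_pdivrMr ?ltr0n// mulrC -ltr_pdivrMr// (lt_le_trans nP)//.
by rewrite ler_nat (leq_trans (leqnSn n)).
Qed.

Section SquareRoot.
Local Opaque opnorm.
Variables (R : realType) (k : nat).
Implicit Types (T : 'M[R[i]]_k) (n m : nat).

Lemma adjoint_mulmx_sqr m (u : 'cV[R[i]]_m) :
  (adjoint u *m u) ord0 ord0 = (\sum_j normc (u j ord0) ^+ 2)%:C%C.
Proof.
rewrite mxE rmorph_sum /=; apply: eq_bigr => j _.
by rewrite rmorphXn /= -normE normCK !mxE mulrC.
Qed.

Lemma adjointB m p (u v : 'M[R[i]]_(m, p)) : adjoint (u - v) = adjoint u - adjoint v.
Proof. by rewrite /adjoint map_mxB linearB. Qed.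

(** Put [w = c v]. Then [|v - c^* w|^2 = |v|^2 - 2 |w|^2 + |c^* w|^2], and Cauchy-Schwarz gives
    [|c^* w| <= |w|]. This brings [1 - c^* c] into the domain of the square root iteration. *)
Lemma opnorm_id_sub_gram m (c : 'M[R[i]]_(m, k)) :
  \sum_l \sum_j normc (c l j) ^+ 2 <= 1 ->
  opnorm (1%:M - adjoint c *m c) <= 1.
Proof.
move=> c1; apply: opnorm_le => v v1; apply: l2norm_le => //; rewrite expr1n.
pose w := c *m v; pose N p (u : 'cV[R[i]]_p) := \sum_j normc (u j ord0) ^+ 2.
have -> : (1%:M - adjoint c *m c) *m v = v - adjoint c *m w.
  by rewrite mulmxBl mul1mx mulmxA.
have Nv : N _ v <= 1.
  by rewrite -[leLHS]l2norm_sqr -(expr1n _ 2) ler_pXn2r ?nnegrE ?l2norm_ge0.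
have Nw0 : 0 <= N _ w by apply: sumr_ge0 => j _; exact: sqr_ge0.
have Ncw : N _ (adjoint c *m w) <= N _ w.
  apply: (@le_trans _ _ (\sum_j (\sum_l normc (c l j) ^+ 2) * N _ w)); last first.
    by rewrite -mulr_suml ler_piMl// exchange_big.
  apply: ler_sum => j _; apply: le_trans (real_CauchySchwarz _ _).
  rewrite ler_pXn2r ?nnegrE ?normc_ge0 ?sumr_ge0// => [|l _]; last first.
    by rewrite mulr_ge0 ?normc_ge0.
  rewrite mxE (le_trans (normc_sum _ _))// ler_sum// => l _.
  by rewrite Normc.normcM !mxE normc_conj.
suff : N _ (v - adjoint c *m w) = N _ v - 2 * N _ w + N _ (adjoint c *m w).
  by rewrite -/(N _ _) => ->; lra.
apply: complexI; rewrite rmorphD rmorphB rmorphM /= -!adjoint_mulmx_sqr.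
rewrite adjointB mulmxBl !mulmxBr opprB.
have -> : adjoint v *m (adjoint c *m w) = adjoint w *m w.
  by rewrite mulmxA -adjointM.
have -> : adjoint (adjoint c *m w) *m v = adjoint w *m w.
  by rewrite adjointM adjointK -mulmxA.
rewrite !mxE; set a := \sum_j _; set b := \sum_j _; set d := \sum_j _.
by rewrite (_ : (2 : R)%:C%C = 2 :> R[i]) ?rmorph_nat//; ring.
Qed.

(** Iterates converging to [1 - sqrt (1 - T)] whenever [opnorm T <= 1]. *)
Fixpoint sqrt_iter T n : 'M[R[i]]_k :=
  if n is n'.+1 then 2^-1 *: (T + sqrt_iter T n' *m sqrt_iter T n') else 0.

(** The scalar iterates at [T = 1], which dominate. *)
Fixpoint sqrt_iter1 n : R :=
  if n is n'.+1 then 2^-1 * (1 + sqrt_iter1 n' ^+ 2) else 0.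

(** The lower bound is an explicit rate of convergence to 1, the fixed point of
    [q |-> (1 + q^2) / 2]; the derivative there is 1, which rules out a geometric rate. *)
Lemma sqrt_iter1_bounds n : 0 <= sqrt_iter1 n /\ 1 - 2 / n.+2%:R <= sqrt_iter1 n <= 1.
Proof.
elim: n => [|n [q0 /andP[ql q1]]] /=.
  by split=> //; rewrite ler01 andbT divff// subrr.
split; first by rewrite mulr_ge0 ?addr_ge0 ?sqr_ge0.
apply/andP; split; last by nra.
move: (sqrt_iter1 n) q0 ql q1 => q q0 ql q1.
have n0 : (0 : R) <= n%:R by rewrite ler0n.
pose t : R := (n%:R + 2)^-1; pose s : R := (n%:R + 3)^-1.
have t0 : 0 < t by rewrite invr_gt0; lra.
have s0 : 0 < s by rewrite invr_gt0; lra.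
have tE : t * (n%:R + 2) = 1 by rewrite mulVf//; lra.
have sE : s * (n%:R + 3) = 1 by rewrite mulVf//; lra.
have -> : n.+3%:R = n%:R + 3 :> R by rewrite -natrD addn3.
have {}ql : 1 - 2 * t <= q.
  by move: ql; rewrite (_ : n.+2%:R = n%:R + 2 :> R) // -natrD addn2.
rewrite -/s.
have t1 : 2 * t <= 1 by nra.
have : (1 - 2 * t) ^+ 2 <= q ^+ 2 by rewrite ler_pXn2r// nnegrE; lra.
(* Putting [1 - 2 * t] for [q] reduces the claim to this inequality, whose defect [s - t + t ^+ 2]
   is exactly [s * t * t]. *)
suff : t - t ^+ 2 <= s by lra.
have : 0 <= s * t * t by rewrite !mulr_ge0 ?ltW.
have -> : s * t * t = s * (t * (n%:R + 2)) ^+ 2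
    - t * (s * (n%:R + 3)) * (t * (n%:R + 2)) + t ^+ 2 * (s * (n%:R + 3)).
  by ring.
by rewrite tE sE; lra.
Qed.

Lemma opnormN T : opnorm (- T) = opnorm T.
Proof.
have le A : opnorm (- A) <= opnorm A :> R.
  by rewrite -scaleN1r (le_trans (opnormZ_le _ _))// normcN Normc.normc1 mul1r.
by apply: le_anti; apply/andP; split; [exact: le|have := le _ (- T); rewrite opprK].
Qed.

Lemma normc_half : normc (2^-1 : R[i]) = 2^-1.
Proof.
by apply: complexI; rewrite -normE ger0_norm ?invr_ge0// fmorphV rmorph_nat.
Qed.

Lemma opnorm_half T : opnorm (2^-1 *: T) <= 2^-1 * opnorm T.
Proof. by rewrite (le_trans (opnormZ_le _ _))// normc_half. Qed.

Lemma opnorm_sqrB T T' :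
  opnorm (T *m T - T' *m T') <= (opnorm T + opnorm T') * opnorm (T - T').
Proof.
rewrite (_ : _ - _ = T *m (T - T') + (T - T') *m T'); last first.
  by rewrite mulmxBr mulmxBl addrA subrK.
apply: le_trans (opnormD _ _) _; rewrite mulrDl; apply: lerD.
  exact: opnormM.
by rewrite mulrC; exact: opnormM.
Qed.

Lemma opnorm0 : opnorm (0 : 'M[R[i]]_k) = 0.
Proof.
by apply/eqP; rewrite eq_le opnorm_ge0 andbT opnorm_le// => v _; rewrite mul0mx l2norm0.
Qed.

Lemma opnorm_sqrt_iter T n : opnorm T <= 1 -> opnorm (sqrt_iter T n) <= sqrt_iter1 n.
Proof.
move=> T1; elim: n => [|n IH] /=; first by rewrite opnorm0.
rewrite (le_trans (opnorm_half _))// ler_wpM2l// (le_trans (opnormD _ _))//.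
rewrite lerD// (le_trans (opnormM _ _))// expr2.
by rewrite ler_pM// opnorm_ge0.
Qed.

(** By [opnorm_sqrB] a difference of squares is at most the sum of the norms times the difference;
    for the scalar iterates this is an equality, so domination passes to the next step. *)
Lemma opnorm_sqrt_iterS T n : opnorm T <= 1 ->
  opnorm (sqrt_iter T n.+1 - sqrt_iter T n) <= sqrt_iter1 n.+1 - sqrt_iter1 n.
Proof.
move=> T1; elim: n => [|n IH].
  rewrite /= mul0mx !addr0 subr0 expr0n/= addr0 subr0.
  by rewrite (le_trans (opnorm_half _))// ler_wpM2l.
rewrite [sqrt_iter T n.+2]/= [X in opnorm (_ - X)]/= -scalerBr.
rewrite (le_trans (opnorm_half _))//.
rewrite [X in opnorm X](_ : _ = sqrt_iter T n.+1 *m sqrt_iter T n.+1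
  - sqrt_iter T n *m sqrt_iter T n); last by rewrite opprD addrACA subrr add0r.
have -> : sqrt_iter1 n.+2 - sqrt_iter1 n.+1 =
    2^-1 * ((sqrt_iter1 n.+1 + sqrt_iter1 n) * (sqrt_iter1 n.+1 - sqrt_iter1 n)).
  have E m : sqrt_iter1 m.+1 = 2^-1 * (1 + sqrt_iter1 m ^+ 2) by [].
  by rewrite (E n.+1) {2}(E n); move: (sqrt_iter1 n.+1) (sqrt_iter1 n) => q q'; ring.
rewrite ler_wpM2l// (le_trans (opnorm_sqrB _ _))//.
rewrite ler_pM ?addr_ge0 ?opnorm_ge0//.
by apply: lerD; exact: opnorm_sqrt_iter.
Qed.

(** The increments telescope against the scalar ones. The bound is uniform in [T], from which
    continuity of the limit will follow. *)
Lemma opnorm_sqrt_iterB T n m : opnorm T <= 1 -> (n <= m)%N ->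
  opnorm (sqrt_iter T m - sqrt_iter T n) <= 2 / n.+2%:R.
Proof.
move=> T1 nm.
have : opnorm (sqrt_iter T m - sqrt_iter T n) <= sqrt_iter1 m - sqrt_iter1 n.
  elim: m nm => [|m IH]; first by rewrite leqn0 => /eqP ->; rewrite !subrr opnorm0.
  rewrite leq_eqVlt => /orP[/eqP ->|/IH {}IH]; first by rewrite !subrr opnorm0.
  rewrite -(subrKA (sqrt_iter T m)) (le_trans (opnormD _ _))//.
  rewrite -[leRHS](subrKA (sqrt_iter1 m)) lerD//; exact: opnorm_sqrt_iterS.
have [_ /andP[+ _]] := sqrt_iter1_bounds n.
have [_ /andP[_]] := sqrt_iter1_bounds m.
move=> qm qn /le_trans; apply; by rewrite lerBlDl (le_trans qm)// -lerBlDr.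
Qed.

(** On the unit ball squaring is 2-Lipschitz, which the factor 1/2 cancels, so each step adds at
    most the distance of [T] and [T']. *)
Lemma opnorm_sqrt_iter_lip T T' n : opnorm T <= 1 -> opnorm T' <= 1 ->
  opnorm (sqrt_iter T n - sqrt_iter T' n) <= n%:R * opnorm (T - T').
Proof.
move=> T1 T'1; elim: n => [|n IH] /=; first by rewrite subrr opnorm0 mul0r.
rewrite -scalerBr.
apply: le_trans (opnorm_half _) _.
rewrite opprD.
rewrite addrACA.
have D0 := opnorm_ge0 (T - T').
have := opnormD (T - T') (sqrt_iter T n *m sqrt_iter T n - sqrt_iter T' n *m sqrt_iter T' n).
have := opnorm_sqrB (sqrt_iter T n) (sqrt_iter T' n).
have [q0 /andP[_ q1]] := sqrt_iter1_bounds n.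
have : (opnorm (sqrt_iter T n) + opnorm (sqrt_iter T' n)) *
    opnorm (sqrt_iter T n - sqrt_iter T' n) <= 2 * opnorm (sqrt_iter T n - sqrt_iter T' n).
  apply: ler_wpM2r; first exact: opnorm_ge0.
  by apply: lerD; apply: le_trans q1; exact: opnorm_sqrt_iter.
rewrite -[n.+1%:R]natr1 [(_ + 1) * _]mulrDl mul1r.
move: (_ * opnorm (sqrt_iter T n - _)) => p.
move: (opnorm (T - T' + _)) (opnorm (_ *m _ - _)) IH D0 => W S.
move: (opnorm (sqrt_iter T n - _)) (opnorm (T - T')) (n%:R) => Z D r.
by clear; move=> *; lra.
Qed.

Lemma opnorm_le_max T (e : R) : 0 <= e -> (forall j l, normc (T j l) <= e) ->
  opnorm T <= (k * k)%:R * e.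
Proof.
move=> e0 Te; rewrite (le_trans (opnorm_le_sum _))//.
apply: (@le_trans _ _ (\sum_(j < k) \sum_(h < k) e)).
  by do 2![apply: ler_sum => ? _].
by rewrite !sumr_const !card_ord -mulrnA mulr_natl.
Qed.

(** The limit is taken entrywise; the return to the operator norm costs the factor [k * k]. *)
Lemma sqrt_iter_limit T : opnorm T <= 1 -> exists Y : 'M[R[i]]_k,
  forall n, opnorm (Y - sqrt_iter T n) <= (k * k)%:R * (2 / n.+2%:R).
Proof.
move=> T1.
have [l Hl] : exists l : 'I_k * 'I_k -> R[i], forall p n,
    normc (l p - sqrt_iter T n p.1 p.2) <= 2 / n.+2%:R.
  suff H p : exists l : R[i], forall n, normc (l - sqrt_iter T n p.1 p.2) <= 2 / n.+2%:R.
    by exists (fun p => projT1 (cid (H p))) => p; exact: projT2 (cid (H p)).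
  have Hc n m : (n <= m)%N ->
      normc (sqrt_iter T m p.1 p.2 - sqrt_iter T n p.1 p.2) <= 2 / n.+2%:R.
    move=> nm; apply: le_trans (opnorm_sqrt_iterB T1 nm).
    by rewrite (le_trans _ (opnorm_entry _ p.1 p.2))// !mxE.
  have [|l Hl] := @complex_complete R ((fun n => sqrt_iter T n p.1 p.2) @ \oo) _.
    move=> e e0; have [|n ne] := @lt_inv_succ R 2 (e / 2); first by rewrite divr_gt0.
    exists [set z | exists2 m, (n <= m)%N & z = sqrt_iter T m p.1 p.2].
      by exists n => // m /= nm; exists m.
    move=> _ _ [m nm ->] [m' nm' ->].
    rewrite -(subrKA (sqrt_iter T n p.1 p.2)) (le_lt_trans (normcD _ _))//.
    by rewrite [e]splitr ltrD// (le_lt_trans _ ne)// ?Hc// normcB Hc.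
  exists l => n; apply/ler_addgt0Pr => e e0.
  have [N _ HN] := Hl e e0.
  have /= lt := HN (maxn N n) (leq_maxl _ _).
  rewrite -(subrKA (sqrt_iter T (maxn N n) p.1 p.2)) (le_trans (normcD _ _))//.
  by rewrite addrC lerD ?Hc ?leq_maxr// normcB ltW.
exists (\matrix_(i, j) l (i, j)) => n; apply: opnorm_le_max.
  by rewrite divr_ge0.
by move=> i j; rewrite !mxE; exact: (Hl (i, j)).
Qed.

End SquareRoot.

Section Gram.
Variables (R : realType).
Local Opaque opnorm.

Lemma opnorm_eq0 k (T : 'M[R[i]]_k) : opnorm T <= 0 -> T = 0.
Proof.
move=> T0; apply/matrixP => j l; rewrite mxE; apply: Normc.eq0_normc.
apply/eqP; rewrite eq_le normc_ge0 andbT.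
by apply: le_trans T0; exact: opnorm_entry.
Qed.

Lemma opnorm_adjoint k (T : 'M[R[i]]_k) : opnorm (adjoint T) = opnorm T.
Proof.
apply: le_anti; apply/andP; split; last exact: opnorm_adjoint_le.
by have := opnorm_adjoint_le (adjoint T); rewrite adjointK.
Qed.

Lemma adjoint_sqrt_iter k (T : 'M[R[i]]_k) n :
  adjoint T = T -> adjoint (sqrt_iter T n) = sqrt_iter T n.
Proof.
move=> aT; elim: n => [|n IH] /=.
  by apply/matrixP => i j; rewrite !mxE rmorph0.
by rewrite adjointZ adjointD adjointM IH aT fmorphV rmorph_nat.
Qed.

(** The limit is self-adjoint and satisfies [2 Y = T + Y Y], a rearrangement of
    [(1 - Y)^2 = 1 - T]. *)
Lemma sqrt_iter_limit_sqr k (T Y : 'M[R[i]]_k) (C : R) : opnorm T <= 1 ->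
  (forall n, opnorm (Y - sqrt_iter T n) <= C * (2 / n.+2%:R)) ->
  adjoint T = T -> adjoint (1%:M - Y) *m (1%:M - Y) = 1%:M - T.
Proof.
move=> T1 HY aT.
have HC e : 0 < e -> exists n, C * (2 / n.+2%:R) < e.
  by move=> e0; have [n] := @lt_inv_succ R (C * 2) e e0; rewrite -mulrA; exists n.
have aY : adjoint Y = Y.
  apply/eqP; rewrite -subr_eq0; apply/eqP/opnorm_eq0/ler_addgt0Pr => e e0.
  have [|n nP] := HC (e / 2); first by rewrite divr_gt0.
  rewrite add0r -(subrKA (sqrt_iter T n)).
  apply: le_trans (opnormD _ _) _.
  rewrite -{1}(adjoint_sqrt_iter n aT) -adjointB opnorm_adjoint.
  rewrite -[X in _ + X]opnormN opprB [e]splitr.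
  by apply: lerD; apply: le_trans (HY n) (ltW nP).
suff : Y + Y = T + Y *m Y.
  move=> E; rewrite adjointB aY (_ : adjoint 1%:M = 1%:M); last first.
    by apply/matrixP => i j; rewrite !mxE eq_sym rmorph_nat.
  rewrite mulmxBl !mulmxBr !mul1mx mulmx1.
  have -> : T = Y + Y - Y *m Y by rewrite E addrK.
  by move: (Y *m Y) => D; apply/matrixP => i j; rewrite !mxE; ring.
apply/eqP; rewrite -subr_eq0; apply/eqP/opnorm_eq0/ler_addgt0Pr => e e0.
rewrite add0r.
(* At [n = 0] the iterate is 0 and [2 / n.+2%:R] is 1, so [HY] bounds [Y] itself by [C]. *)
have C0 : 0 <= C.
  have := le_trans (opnorm_ge0 _) (HY 0%N).
  by rewrite divff ?mulr1// pnatr_eq0.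
(* The error consists of [Y - y'] twice and of [Y Y - y y], bounded with the factor [C + 1]; hence
   [C + 3]. *)
have [|n nP] := HC (e / (C + 3)); first by rewrite divr_gt0//; lra.
pose y := sqrt_iter T n; pose y' := sqrt_iter T n.+1.
have Ey : y' + y' = T + y *m y.
  by rewrite -mulr2n -scaler_nat /y' /= scalerA mulfV ?scale1r// pnatr_eq0.
have -> : Y + Y - (T + Y *m Y) = ((Y - y') + (Y - y')) + - (Y *m Y - y *m y).
  have -> : T = y' + y' - y *m y by rewrite Ey addrK.
  move: (Y *m Y) (y *m y) => D d; apply/matrixP => i j; rewrite !mxE; ring.
have YC : opnorm Y <= C.
  by have := HY 0%N; rewrite /= subr0 divff ?mulr1// pnatr_eq0.
have y1 : opnorm y <= 1.
  have [_ /andP[_]] := @sqrt_iter1_bounds R n.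
  by apply: le_trans; exact: opnorm_sqrt_iter.
have Hy : opnorm (Y - y) <= e / (C + 3) by apply: le_trans (HY n) (ltW nP).
have Hy' : opnorm (Y - y') <= e / (C + 3).
  apply: (@le_trans _ _ (C * (2 / n.+3%:R))); first exact: HY.
  apply: (@le_trans _ _ (C * (2 / n.+2%:R))); last exact: (ltW nP).
  apply: (ler_wpM2l C0); apply: (ler_wpM2l (ler0n _ 2)).
  by rewrite lef_pV2 ?posrE// ler_nat.
clearbody y y'; apply: le_trans (opnormD _ _) _; rewrite opnormN.
apply: (@le_trans _ _ (e / (C + 3) + e / (C + 3) + (C + 1) * (e / (C + 3)))).
  apply: lerD.
    by apply: le_trans (opnormD _ _) _; apply: lerD; exact: Hy'.
  apply: le_trans (opnorm_sqrB _ _) _; apply: ler_pM.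
  - by apply: addr_ge0; exact: opnorm_ge0.
  - exact: opnorm_ge0.
  - exact: lerD YC y1.
  - exact: Hy.
have -> : e / (C + 3) + e / (C + 3) + (C + 1) * (e / (C + 3)) = e.
  by clear -C0; field; lra.
exact: lexx.
Qed.

(** A uniform limit of Lipschitz maps is continuous: the two tails take two thirds of [e], the
    Lipschitz bound for the [n]-th iterate the last third. *)
Lemma exists_continuous_sqrt k : exists S : 'M[R[i]]_k -> 'M[R[i]]_k,
  (forall T, opnorm T <= 1 -> adjoint T = T -> adjoint (S T) *m S T = 1%:M - T) /\
  (forall T e, opnorm T <= 1 -> 0 < e -> exists2 d, 0 < d &
     forall T', opnorm T' <= 1 -> opnorm (T - T') < d -> opnorm (S T - S T') < e).
Proof.
have H (T : 'M[R[i]]_k) : exists Y : 'M[R[i]]_k, opnorm T <= 1 ->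
    forall n, opnorm (Y - sqrt_iter T n) <= (k * k)%:R * (2 / n.+2%:R).
  have [T1|T1] := pselect (opnorm T <= 1); last by exists 0.
  by have [Y HY] := sqrt_iter_limit T1; exists Y.
have [Y HY] := choice H.
exists (fun T => 1%:M - Y T); split=> [T T1|T e T1 e0].
  exact: sqrt_iter_limit_sqr T1 (HY T T1).
have [|n nP] := @lt_inv_succ R ((k * k)%:R * 2) (e / 3); first by rewrite divr_gt0.
rewrite -mulrA in nP.
exists (e / 3 / n.+1%:R) => [|T' T'1 TT']; first by rewrite !divr_gt0.
move: (HY T T1 n) (HY T' T'1 n) => {HY}.
move: (Y T) (Y T') => {}Y Y' HY HY'.
have -> : 1%:M - Y - (1%:M - Y') =
    (Y' - sqrt_iter T' n) +
    - (Y - sqrt_iter T n) + - (sqrt_iter T n - sqrt_iter T' n).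
  move: (sqrt_iter T n) (sqrt_iter T' n) => y y'.
  by apply/matrixP => i j; rewrite !mxE; ring.
apply: le_lt_trans (opnormD _ _) _; rewrite opnormN.
rewrite (_ : e = e / 3 + e / 3 + e / 3); last by field.
apply: ler_ltD.
  apply: le_trans (opnormD _ _) _; rewrite opnormN.
  by apply: lerD; [apply: le_trans HY' (ltW nP)|apply: le_trans HY (ltW nP)].
apply: le_lt_trans (opnorm_sqrt_iter_lip n T1 T'1) _.
apply: (@le_lt_trans _ _ (n.+1%:R * opnorm (T - T'))).
  by apply: ler_wpM2r; [exact: opnorm_ge0|rewrite ler_nat].
by rewrite mulrC -ltr_pdivlMr.
Qed.
End Gram.

(** * Gram matrices over C0(X) *)

Section C0Gram.
Variables (R : realType) (X : topologicalType).
Local Opaque opnorm.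
Implicit Types f g : C0 R X.

Lemma conj_real_complex (r : R) : Num.conj r%:C%C = r%:C%C :> R[i].
Proof. exact: conjc_real. Qed.

Lemma C0_sumE (I : Type) (s : seq I) (P : pred I) (f : I -> C0 R X) x :
  (\sum_(i <- s | P i) f i) x = \sum_(i <- s | P i) f i x.
Proof. by elim/big_rec2: _ => // i y z _ <-. Qed.

Lemma C0_mulE f g x : (f ** g) x = f x * g x.
Proof. by []. Qed.

Lemma C0_starE f x : (star f : C0 R X) x = Num.conj (f x).
Proof. by []. Qed.

Lemma C0_near f x (e : R) : 0 < e -> \forall y \near x, normc (f x - f y) < e.
Proof. by have /continuous_complexP := @C0_continuous _ _ f; apply. Qed.

(* The columns [c] have a pointwise positive Gram matrix, whose pointwise square
   root is continuous and vanishes at infinity along with its diagonal. *)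
Lemma C0_gram (L : finType) k (c : L -> 'I_k -> C0 R X) :
  exists b : 'M[C0 R X]_k, forall i j,
    \sum_l star (c l i) ** c l j = \sum_l star (b l i) ** b l j.
Proof.
(* Division by [M], a bound for the pointwise traces, brings the Gram matrix below the identity; the
   summand 1 keeps [M] positive. *)
pose M : R := 1 + \sum_l \sum_j C0_norm (c l j) ^+ 2.
have M0 : 0 < M.
  apply: ltr_pwDl => //; apply: sumr_ge0 => l _; apply: sumr_ge0 => j _.
  exact: sqr_ge0.
pose s := Num.sqrt M; have s0 : 0 < s by rewrite sqrtr_gt0.
have ss : s * s = M by rewrite -expr2 sqr_sqrtr// ltW.
pose A i j : C0 R X := \sum_l star (c l i) ** c l j.
pose m x : 'M[R[i]]_(#|{: L}|, k) :=
  \matrix_(l, j) ((s^-1)%:C%C * c (enum_val l) j x).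
pose a x := adjoint (m x) *m m x.
have aE x i j : a x i j = (M^-1)%:C%C * A i j x.
  rewrite mxE C0_sumE mulr_sumr.
  rewrite [RHS](reindex_onto enum_val enum_rank)/= => [|l _]; last exact: enum_rankK.
  apply: eq_big => [l|l _]; first by rewrite enum_valK eqxx.
  rewrite !mxE rmorphM /= conj_real_complex mulrACA -rmorphM /=.
  by rewrite -invfM ss.
have T1 x : opnorm (1%:M - a x) <= 1.
  apply: opnorm_id_sub_gram.
  have E l j : normc (m x l j) ^+ 2 = M^-1 * normc (c (enum_val l) j x) ^+ 2.
    rewrite mxE Normc.normcM exprMn; congr (_ * _).
    rewrite -ss invfM -expr2; congr (_ ^+ 2); apply: complexI.
    by rewrite -normE ger0_norm// lecR invr_ge0 ltW.
  under eq_bigr => l _ do (under eq_bigr => j _ do rewrite E).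
  under eq_bigr => l _ do rewrite -mulr_sumr.
  rewrite -mulr_sumr mulrC ler_pdivrMr// mul1r.
  have -> : \sum_(l < #|{: L}|) \sum_j normc (c (enum_val l) j x) ^+ 2 =
      \sum_l \sum_j normc (c l j x) ^+ 2.
    rewrite [RHS](reindex_onto enum_val enum_rank)/= => [|l _]; last exact: enum_rankK.
    by apply: eq_bigl => l; rewrite enum_valK eqxx.
  apply: (@le_trans _ _ (\sum_l \sum_j C0_norm (c l j) ^+ 2)); last by rewrite lerDr.
  apply: ler_sum => l _; apply: ler_sum => j _.
  by rewrite ler_pXn2r ?nnegrE ?normc_ge0 ?C0_norm_ge0 ?C0_norm_ub.
have aT x : adjoint (1%:M - a x) = 1%:M - a x.
  rewrite adjointB adjointM adjointK (_ : adjoint 1%:M = 1%:M)//.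
  by apply/matrixP => i j; rewrite !mxE eq_sym rmorph_nat.
have [S [Ssqr Scont]] := @exists_continuous_sqrt R k.
pose b x := s%:C%C *: S (1%:M - a x).
have bE x i j : \sum_l Num.conj (b x l i) * b x l j = A i j x.
  have -> : \sum_l Num.conj (b x l i) * b x l j = (adjoint (b x) *m b x) i j.
    by rewrite mxE; apply: eq_bigr => l _; rewrite !mxE.
  rewrite adjointZ -scalemxAl -scalemxAr scalerA Ssqr// opprB addrC subrK.
  rewrite mxE aE conj_real_complex -rmorphM /= ss mulrA -rmorphM /=.
  by rewrite divff ?mul1r// gt_eqF.
have b_cont l j : continuous (fun x => b x l j : R[i]^o).
  apply/continuous_complexP => x e e0.
  have [|d d0 Hd] := Scont (1%:M - a x) (e / s) (T1 x); first by rewrite divr_gt0.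
  pose D : R := (k * k)%:R + 1; have D0 : 0 < D by rewrite ltr_wpDl.
  have dD0 : 0 < d / D / M^-1 by rewrite !divr_gt0// invr_gt0.
  have : \forall y \near x, forall p : 'I_k * 'I_k,
      normc (A p.1 p.2 x - A p.1 p.2 y) < d / D / M^-1.
    by apply: filter_forall => p; exact: C0_near.
  apply: filterS => y Hy.
  have scaleB (P Q : 'M[R[i]]_k) :
      (s%:C%C *: P) l j - (s%:C%C *: Q) l j = s%:C%C * (P - Q) l j.
    by rewrite !mxE mulrBr.
  rewrite /b scaleB Normc.normcM.
  have -> : normc (s%:C%C : R[i]) = s.
    by apply: complexI; rewrite -normE ger0_norm// lecR ltW.
  rewrite mulrC -ltr_pdivlMr//.
  apply: (@le_lt_trans _ _ (opnorm (S (1%:M - a x) - S (1%:M - a y)))).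
    exact: opnorm_entry.
  apply: Hd => //.
  apply: (@le_lt_trans _ _ ((k * k)%:R * (d / D))); last first.
    by rewrite mulrCA gtr_pMr// ltr_pdivrMr// mul1r ltrDl.
  apply: opnorm_le_max => [|i h]; first by rewrite ltW// divr_gt0.
  have -> : (1%:M - a x - (1%:M - a y)) i h = (M^-1)%:C%C * - (A i h x - A i h y).
    rewrite mulrN mulrBr -!aE !mxE; ring.
  rewrite Normc.normcM normcN.
  have -> : normc ((M^-1)%:C%C : R[i]) = M^-1.
    by apply: complexI; rewrite -normE ger0_norm// lecR invr_ge0 ltW.
  by rewrite mulrC -ler_pdivlMr ?invr_gt0// ltW// (Hy (i, h)).
have b_van l j (e : R) : 0 < e -> compact [set x | e%:C%C <= `|b x l j : R[i]^o|].
  move: e; apply: (@C0_vanish_le _ _ _ (fun e => [set x | (e ^+ 2)%:C%C <= `|A j j x|])).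
  - exact: b_cont.
  - by move=> e e0; apply: C0_vanish; rewrite exprn_gt0.
  move=> e x e0 /= /negP; rewrite normE lecR -ltNge => Ae.
  rewrite -(@ltr_pXn2r _ 2) ?nnegrE ?normc_ge0 ?(ltW e0)//.
  apply: le_lt_trans Ae; rewrite -lecR -normE -bE.
  have E h : Num.conj (b x h j) * b x h j = (normc (b x h j) ^+ 2)%:C%C.
    by rewrite rmorphXn /= -normE normCK mulrC.
  under eq_bigr => h _ do rewrite E.
  rewrite -rmorph_sum /= ger0_norm ?lecR; last first.
    by apply: sumr_ge0 => h _; exact: sqr_ge0.
  by rewrite (bigD1 l)//= lerDl sumr_ge0// => h _; exact: sqr_ge0.
exists (\matrix_(l, j) MkC0 (@b_cont l j) (b_van l j)) => i j.
apply: C0_eq => x; rewrite [RHS]C0_sumE -[LHS]/(A i j x) -bE.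
by clearbody b; apply: eq_bigr => l _; rewrite !mxE.
Qed.

End C0Gram.

(** * From covering dimension to decomposition rank *)

Section ColouredPartition.
Variables (R : realType) (X : topologicalType).

Section Barycentric.
Variables (I : finType) (h : I -> X -> R).
Hypothesis h_continuous : forall i, continuous (h i).
Hypothesis h_ge0 : forall i x, 0 <= h i x.
Implicit Types (S : {set I}) (x : X).

(** A bump supported where the [h i], [i \in S], are positive and dominate all
    the others: an open star of the barycentric subdivision. *)
Definition star_bump S x : R :=
  (\prod_(i in S) \prod_(j in ~: S) Num.max 0 (h i x - h j x)) * \prod_(i in S) h i x.

Lemma star_bump_continuous S : continuous (star_bump S).
Proof.
move=> x; apply: cvgM; last by apply: continuous_prod.
apply: continuous_prod => i _; apply: continuous_prod => j _ y.
apply: (@continuous_max _ _ (fun=> 0) (fun x => h i x - h j x)); first exact: cvg_cst.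
by apply: cvgB; exact: h_continuous.
Qed.

Lemma star_bump_ge0 S x : 0 <= star_bump S x.
Proof.
rewrite mulr_ge0 ?prodr_ge0// => i _; rewrite prodr_ge0// => j _.
by rewrite le_max lexx.
Qed.

Lemma star_bump_neq0 S x : star_bump S x != 0 <->
  (forall i, i \in S -> h i x != 0) /\
  (forall i j, i \in S -> j \notin S -> h j x < h i x).
Proof.
rewrite mulf_eq0 negb_or; split.
  move=> /andP[/prodf_neq0 P1 /prodf_neq0 P2]; split=> // i j iS jS.
  have /prodf_neq0/(_ j) := P1 i iS; rewrite inE => /(_ jS).
  apply: contraNT; rewrite -leNgt => hij.
  by apply/eqP/max_idPl; rewrite subr_le0.
move=> [P1 P2]; apply/andP; split; last exact/prodf_neq0.
apply/prodf_neq0 => i iS; apply/prodf_neq0 => j; rewrite inE => jS.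
have hji := P2 i j iS jS.
by rewrite (max_idPr _) ?subr_eq0 ?gt_eqF// ltW// subr_gt0.
Qed.

(** Each of two distinct sets of equal size has an element outside the other. If both bumps were
    nonzero at [x], each of the two corresponding values of [h] would exceed the other. *)
Lemma star_bump_disjoint S S' x : #|S| = #|S'| -> S != S' ->
  star_bump S x * star_bump S' x = 0.
Proof.
move=> SS' neq; apply/eqP; rewrite mulf_eq0.
apply/contraT; rewrite negb_or => /andP[/star_bump_neq0[_ H] /star_bump_neq0[_ H']].
have /subsetPn[i iS iS'] : ~~ (S \subset S').
  by apply: contra neq => sub; rewrite eqEcard sub SS' /=.
have /subsetPn[j jS' jS] : ~~ (S' \subset S).
  by apply: contra neq => sub; rewrite eq_sym eqEcard sub SS' /=.
by have := lt_trans (H i j iS jS) (H' j i jS' iS'); rewrite ltxx.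
Qed.

End Barycentric.

Lemma coloured_partition n (I : finType) (V : I -> set X) (K : set X) :
  locally_compact [set: X] -> hausdorff_space X -> normal_space X ->
  compact K -> (forall i, open (V i)) -> K `<=` \bigcup_i V i -> order_le V n ->
  exists (s : nat) (u : 'I_s -> X -> R) (p : 'I_s -> X) (i : 'I_s -> I)
    (c : 'I_s -> 'I_n.+1),
  [/\ forall a, continuous (u a) /\
        exists2 C, compact C & forall x, ~ C x -> u a x = 0,
      forall a x, 0 <= u a x,
      forall x, \sum_a u a x <= 1 /\ (K x -> \sum_a u a x = 1),
      forall a, V (i a) (p a) /\ (forall x, u a x != 0 -> V (i a) x) &
      forall a b x, a != b -> c a = c b -> u a x * u b x = 0].
Proof.
move=> lX hX nX cK oV KV Vn.
have [h [ch h01 hK [C CV hC]]] := @bump_family R X lX hX I K V cK oV KV.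
have h0 i x : 0 <= h i x by have /andP[] := h01 i x.
have hV i x : h i x != 0 -> V i x.
  move=> hx; apply: (CV i).2; apply: contrapT => /hC hx0.
  by rewrite hx0 eqxx in hx.
pose g := star_bump h.
(* The empty set is excluded because its bump is constantly 1; nonvanishing supplies the evaluation
   points. *)
pose P (S : {set I}) := (S != finset.set0) && `[< exists x, g S x != 0 >].
pose G x := \sum_(S : {set I} | S != finset.set0) g S x.
have cG : continuous G by apply: continuous_sum => S _; exact: star_bump_continuous.
have G0 x : 0 <= G x by apply: sumr_ge0 => S _; exact: star_bump_ge0.
have GP x : G x = \sum_(S | P S) g S x.
  rewrite /G (bigID (fun S : {set I} => `[< exists x, g S x != 0 >]))/=.
  rewrite [X in _ + X]big1 ?addr0// => S /andP[_ /asboolP nS].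
  by apply/eqP; apply: contrapT => /negP gx; apply: nS; exists x.
have GK x : K x -> 0 < G x.
  (* The indices where [h] attains its maximal value 1 at [x] span a star containing [x]. *)
  move=> /hK[i hi]; pose S := [set i | h i x == 1]%SET.
  rewrite /G (bigD1 S)/=; last by apply/set0Pn; exists i; rewrite inE hi.
  rewrite ltr_wpDr//; first by apply: sumr_ge0 => S' _; exact: star_bump_ge0.
  rewrite lt_neqAle star_bump_ge0// andbT eq_sym; apply/star_bump_neq0 => //.
  split=> [j|j j']; rewrite !inE => /eqP ->; first exact: oner_neq0.
  by move=> hj; rewrite lt_neqAle hj; have /andP[] := h01 j' x.
(* A Urysohn function makes [G + t] positive everywhere without changing [G] on [K], so the
   quotients sum to 1 there. *)
have [t [ct t01 tK tG]] : exists t : X -> R, [/\ continuous t,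
    forall x, 0 <= t x, forall x, K x -> t x = 0 & forall x, G x = 0 -> 0 < t x].
  have /(@uniform_separatorP _ R)[t [ct t01 tK tG]] :
      uniform_separator K (G @^-1` [set 0]).
    apply: (iffLR normal_separatorP nX); first exact: R.
    - exact: compact_closed.
    - by apply: closed_comp => [x _|]; [exact: cG|exact: closed_eq].
    by rewrite -subset0 => x [/GK + /= Gx]; rewrite Gx ltxx.
  exists t; split=> // x.
  - have : `[0, 1]%classic (t x) by apply: t01; exists x.
    by rewrite /= in_itv /= => /andP[].
  - by move=> Kx; have : [set 0] (t x) by apply: tK; exists x.
  - move=> Gx; have -> : t x = 1; last by [].
    by have : [set 1] (t x) by apply: tG; exists x.
have Gt x : 0 < G x + t x.
  have := G0 x; rewrite le_eqVlt => /orP[/eqP Gx|Gx]; last by rewrite ltr_pwDl.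
  by rewrite -Gx add0r tG.
pose s := #|P|; pose S (a : 'I_s) : {set I} := enum_val a.
have SP a : P (S a) by exact: (enum_valP a).
have Sx a : exists x, g (S a) x != 0 by have /andP[_ /asboolP] := SP a.
have Si a : exists i, i \in S a by have /andP[/set0Pn] := SP a.
pose u a x := g (S a) x / (G x + t x).
have uE a x : (u a x != 0) = (g (S a) x != 0).
  by rewrite mulf_eq0 invr_eq0 negb_or (gt_eqF (Gt x)) andbT.
have sumu x : \sum_a u a x = G x / (G x + t x).
  rewrite -mulr_suml; congr (_ / _); rewrite GP.
  by rewrite [RHS]big_enum_val.
(* A bump that is nonzero at [x] puts [x] into [V i] for every [i] in its set, so the order of [V]
   bounds the cardinality. *)
have cardS a : (0 < #|S a| <= n.+1)%N.
  have /andP[S0 /asboolP[x gx]] := SP a; rewrite card_gt0 S0 /= leqNgt.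
  apply/negP => ltn; pose l (k : 'I_n.+2) := enum_val (widen_ord ltn k).
  have /Vn : injective l.
    by move=> k k' /enum_val_inj/(congr1 val) /= kk'; apply/val_inj.
  rewrite -subset0; apply => k _; apply: hV.
  by have [+ _] := (iffLR (star_bump_neq0 h _ _)) gx; apply; exact: enum_valP.
pose i a := projT1 (cid (Si a)).
have iS a : i a \in S a by exact: projT2 (cid (Si a)).
have gV a x : g (S a) x != 0 -> V (i a) x.
  by move=> /(iffLR (star_bump_neq0 h _ _))[/(_ _ (iS a)) /hV].
(* The colour is the cardinality less one, so distinct sets of one colour fall under
   [star_bump_disjoint]. *)
exists s, u, (fun a => projT1 (cid (Sx a))), i, (fun a => inord #|S a|.-1); split.
- move=> a; split.
    move=> x; apply: cvgM; first exact: star_bump_continuous.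
    by apply: cvgV; [rewrite gt_eqF|apply: cvgD; [exact: cG|exact: ct]].
  exists (C (i a)) => [|x nC]; first by have [] := CV (i a).
  apply/eqP; apply: contrapT => /negP; rewrite uE.
  move=> /(iffLR (star_bump_neq0 h _ _))[/(_ _ (iS a))].
  by rewrite hC// eqxx.
- by move=> a x; rewrite divr_ge0 ?star_bump_ge0// ltW.
- move=> x; rewrite sumu ler_pdivrMr// mul1r lerDl; split=> // Kx.
  by rewrite tK// addr0 divff// gt_eqF// GK.
- by move=> a; split=> [|x]; [exact/gV/(projT2 (cid (Sx a)))|rewrite uE => /gV].
move=> a b x ab /(congr1 (@nat_of_ord _)); rewrite !inordK; last 2 first.
- by have /andP[] := cardS b; case: #|_|.
- by have /andP[] := cardS a; case: #|_|.
move=> Sab; rewrite /u mulrACA star_bump_disjoint ?mul0r//.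
  have /andP[Sa _] := cardS a; have /andP[Sb _] := cardS b.
  by rewrite -(prednK Sa) -(prednK Sb) Sab.
by apply: contra ab => /eqP/enum_val_inj ->.
Qed.

End ColouredPartition.

Section RealFunctions.
Variables (R : realType) (X : topologicalType).
Local Open Scope complex_scope.

Lemma normc_real (r : R) : normc (r%:C : R[i]) = `|r|.
Proof. by rewrite /= expr0n /= addr0 sqrtr_sqr. Qed.

Variables (u : X -> R) (u_continuous : continuous u).
Hypothesis u_support : exists2 C, compact C & forall x, ~ C x -> u x = 0.

Lemma real_C0_continuous : continuous (fun x => (u x)%:C : R[i]^o).
Proof.
apply/continuous_complexP => x e e0.
have /cvgrPdist_lt /(_ e e0) := @u_continuous x.
by apply: filterS => y; rewrite -rmorphB normc_real.
Qed.

Lemma real_C0_vanish (e : R) : 0 < e -> compact [set x | e%:C <= `|(u x)%:C : R[i]^o|].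
Proof.
have [C cC uC] := u_support; move: e.
apply: (@C0_vanish_le _ _ _ (fun=> C)); first exact: real_C0_continuous.
  by [].
by move=> e x e0 /uC ->; rewrite normc_real normr0.
Qed.

Definition real_C0 : C0 R X := MkC0 real_C0_continuous real_C0_vanish.

End RealFunctions.

(** * Evaluation at points and synthesis from a partition of unity *)

Section UpperBound.
Variables (R : realType) (X : topologicalType).
Local Opaque opnorm.

Section Maps.
Variable s : nat.
Notation F := (@fdalg R 'I_s (fun=> 1%N)).

Section Evaluation.
Variable p : 'I_s -> X.

Definition eval_map (f : C0 R X) : F := fun a => (f (p a))%:M.

Lemma eval_map_linear : linear eval_map.
Proof.
move=> k f g; apply: fd_eq => a; apply/matrixP => i j.
rewrite [RHS]mxE [X in _ = X + _]mxE.
by rewrite /eval_map !mxE /= mulrnAr -mulrnDl.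
Qed.

HB.instance Definition _ :=
  GRing.isLinear.Build R[i] (C0 R X) F _ eval_map eval_map_linear.

Lemma eval_map_star f : eval_map (star f) = star (eval_map f).
Proof.
apply: fd_eq => a; apply/matrixP => i j.
by rewrite !ord1 !mxE !eqxx.
Qed.

Lemma eval_mapM f g : eval_map (f ** g) = eval_map f ** eval_map g.
Proof.
by apply: fd_eq => a; rewrite /eval_map -[RHS]/(_ *m _) -scalar_mxM.
Qed.

Lemma eval_map_cpc : cpc eval_map.
Proof.
split=> [k a [b ab]|f].
  exists (map_mx eval_map b) => i j; rewrite mxE ab linear_sum.
  by apply: eq_bigr => l _; rewrite [LHS]eval_mapM eval_map_star !mxE.
rewrite fd_normE C0_normE lecR; apply: fd_norm_le; first exact: C0_norm_ge0.
move=> a; apply: opnorm_le => v v1; rewrite mul_scalar_mx l2normZ.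
apply: le_trans (C0_norm_ub f (p a)).
by rewrite ler_piMr// normc_ge0.
Qed.

End Evaluation.

Section Synthesis.
Variable u : 'I_s -> C0 R X.

Definition synthesis (y : F) : C0 R X := \sum_a y a ord0 ord0 *: u a.

Lemma synthesis_linear : linear synthesis.
Proof.
move=> k y z; rewrite /synthesis scaler_sumr -big_split; apply: eq_bigr => a _ /=.
by rewrite scalerA -scalerDl; congr (_ *: _); rewrite [LHS]mxE [X in X + _]mxE.
Qed.

HB.instance Definition _ :=
  GRing.isLinear.Build R[i] F (C0 R X) _ synthesis synthesis_linear.

Lemma synthesisE y x : synthesis y x = \sum_a y a ord0 ord0 * u a x.
Proof. by rewrite C0_sumE. Qed.

(** The image of [b^* b] is the Gram matrix of the columns with entries [b l j a * v a], indexed by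
    pairs of a summand [a] and a row [l]; [C0_gram] replaces them by a square root of size [k]. *)
Lemma synthesis_cp (v : 'I_s -> C0 R X) : (forall a, u a = star (v a) ** v a) ->
  completely_positive synthesis.
Proof.
move=> uv k a [b ab].
pose c (t : 'I_s * 'I_k) j : C0 R X := b t.2 j t.1 ord0 ord0 *: v t.1.
have [d cd] := C0_gram c; exists d => i j; rewrite mxE -cd.
rewrite -(pair_bigA _ (fun a l => star (c (a, l) i) ** c (a, l) j))/=.
apply: C0_eq => x; rewrite synthesisE C0_sumE; apply: eq_bigr => t _.
rewrite C0_sumE ab.
have -> : (\sum_l star (b l i) ** b l j) t ord0 ord0 =
    \sum_l Num.conj (b l i t ord0 ord0) * b l j t ord0 ord0.
  elim/big_rec2: _ => [|l y z _ <-]; first by rewrite mxE.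
  by rewrite [LHS]mxE; congr (_ + _); rewrite [LHS]mxE big_ord1 !mxE.
rewrite mulr_suml; apply: eq_bigr => l _.
rewrite uv -[(star (v t) ** v t) x]/(Num.conj (v t x) * v t x).
rewrite -[RHS]/(Num.conj (b l i t ord0 ord0 * v t x) * (b l j t ord0 ord0 * v t x)).
by rewrite rmorphM mulrACA.
Qed.

Lemma synthesis_contractive (w : 'I_s -> X -> R) :
  (forall a x, u a x = (w a x)%:C%C) -> (forall a x, 0 <= w a x) ->
  (forall x, \sum_a w a x <= 1) -> contractive synthesis.
Proof.
move=> uw w0 w1 y; rewrite fd_normE C0_normE lecR.
apply: C0_norm_le => [|x]; first exact: fd_norm_ge0.
rewrite synthesisE; apply: le_trans (normc_sum _ _) _.
apply: (@le_trans _ _ (\sum_a fd_norm y * w a x)).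
  apply: ler_sum => a _; rewrite uw Normc.normcM normc_real ger0_norm//.
  apply: ler_wpM2r => //; apply: le_trans (fd_norm_ub y a).
  exact: opnorm_entry.
by rewrite -mulr_sumr ler_piMr// fd_norm_ge0.
Qed.

(** Expand the product over pairs of summands: distinct summands of one colour have disjoint [u],
    those of another colour carry 0, and on the diagonal [e ** e' = 0] is a product of scalars. *)
Lemma synthesis_decomposable n (c : 'I_s -> 'I_n.+1) :
  (forall a b x, a != b -> c a = c b -> u a x * u b x = 0) ->
  n_decomposable n synthesis.
Proof.
move=> cu; exists c => j e e' _ _ ee'; apply: C0_eq => x.
rewrite /comp C0_mulE !synthesisE mulr_suml; apply: big1 => a _.
rewrite mulr_sumr; apply: big1 => b _; rewrite mulrACA.
have [ab|ab] := eqVneq a b; last first.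
  have [cab|cab] := eqVneq (c a) (c b); first by rewrite cu ?mulr0.
  rewrite /fd_incl; case: {-}_ / (@idP (c a == j)) => [ca|_]; last first.
    by rewrite mxE !mul0r.
  case: {-}_ / (@idP (c b == j)) => [cb|_]; last by rewrite mxE mulr0 mul0r.
  by rewrite (eqP ca) (eqP cb) eqxx in cab.
rewrite -{b}ab /fd_incl; case: {-}_ / (@idP (c a == j)) => [ca|_]; last first.
  by rewrite mxE !mul0r.
have := congr1 (fun f : fdalg R (fun k : {k | c k == j} => 1%N) =>
   f (exist _ a ca) ord0 ord0) ee'.
rewrite -[X in X = _ -> _]/((e (exist _ a ca) *m e' (exist _ a ca)) ord0 ord0).
by rewrite !mxE big_ord1 => ->; rewrite mul0r.
Qed.

End Synthesis.
End Maps.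

(** Finitely many neighbourhoods of small oscillation cover [K]. The member at [None] is the
    complement of [K], where all values are small already. *)
Lemma oscillation_cover m (b : 'I_m -> C0 R X) (K : set X) (e : R) :
  hausdorff_space X -> compact K -> 0 < e ->
  (forall x l, ~ K x -> normc (b l x) < e) ->
  exists (I : finType) (U : I -> set X), [/\ forall i, open (U i),
    \bigcup_i U i = setT &
    forall i y z l, U i y -> U i z -> normc (b l y - b l z) <= e + e].
Proof.
move=> hX cK e0 nK.
pose f (x : X) : set X := [set y | forall l, normc (b l x - b l y) < e]°.
have [|x Kx|D _ KD] := @compact_cover_compact _ K cK X K f.
- by move=> x _; exact: open_interior.
- by exists x => //; apply: filter_forall => l; exact: C0_near.
exists (option D), (fun i => if i is Some x then f (val x) else ~` K); split.
- move=> [x|]; first exact: open_interior.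
  by apply: closed_openC; exact: compact_closed.
- apply/seteqP; split=> // x _; have [/KD[y /= yD xy]|nKx] := pselect (K x).
    by exists (Some [` yD]%fset).
  by exists None.
move=> [x|] y z l.
  move=> /interior_subset/(_ l) xy /interior_subset/(_ l) xz.
  rewrite -(subrKA (b l (val x))); apply: le_trans (normcD _ _) _.
  by apply: lerD; [rewrite normcB|]; exact: ltW.
move=> /nK-/(_ l) by_ /nK-/(_ l) bz; apply: le_trans (normcD _ _) _.
by rewrite normcN; apply: lerD; exact: ltW.
Qed.

Lemma decomposition_rank_le_covering_dim n :
  locally_compact [set: X] -> hausdorff_space X -> normal_space X ->
  covering_dim_le X n -> decomposition_rank_le (C0 R X) n.
Proof.
move=> lX hX nX dX m b e e0.
(* The final error is at most [d + d], the oscillation on one [U i], and this is half of [e]. *)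
pose d := e / 4; have d0 : 0 < d by rewrite divr_gt0.
pose K := \big[setU/set0]_(l < m) [set x | d%:C%C <= `|b l x|].
have cK : compact K.
  by apply: bigsetU_compact => l _; exact: C0_vanish.
have nK x l : ~ K x -> normc (b l x) < d.
  rewrite /K -bigcup_seq => nKx; rewrite ltNge; apply/negP => dl; apply: nKx.
  by exists l; rewrite //= ?mem_index_enum// normE lecR.
have [I [U [oU cU bU]]] := @oscillation_cover m b K d hX cK d0 nK.
have [J [V0 [oV0 cV0 VU0 Vn0]]] := dX I U oU cU.
(* The refinement may be infinite; merging its members below a common [U i] leaves a finite family
   of the same order. *)
pose a j := Some (projT1 (cid (VU0 j))).
pose V i := \bigcup_(j in [set j | a j = Some i]) V0 j.
have Vn : order_le V n by exact: order_le_merge.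
have oV i : open (V i) by apply: bigcup_open.
have VU i : V i `<=` U i.
  by move=> x [j [<-] Vx]; exact: (projT2 (cid (VU0 j))).
have KV : K `<=` \bigcup_i V i.
  move=> x _; have : setT x by [].
  by rewrite -cV0 => -[j _ Vx]; exists (projT1 (cid (VU0 j))) => //; exists j.
have [s [u [p [i [c [Hu u0 u1 Vp uc]]]]]] :=
  @coloured_partition R X n I V K lX hX nX cK oV KV Vn.
pose w q : C0 R X := real_C0 (Hu q).1 (Hu q).2.
(* Square roots of the weights provide the factorisation that [synthesis_cp] asks for. *)
have cs q : continuous (fun x => Num.sqrt (u q x)).
  by move=> x; apply: continuous_comp; [exact: (Hu q).1|exact: sqrt_continuous].
have ss q : exists2 C, compact C & forall x, ~ C x -> Num.sqrt (u q x) = 0.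
  by have [C cC uC] := (Hu q).2; exists C => // x /uC ->; rewrite sqrtr0.
pose v q : C0 R X := real_C0 (@cs q) (ss q).
have wv q : w q = star (v q) ** v q.
  apply: C0_eq => x; rewrite C0_mulE C0_starE /= conj_real_complex.
  by rewrite -rmorphM /= -expr2 sqr_sqrtr.
exists s, (fun=> 1%N), (eval_map p), (synthesis w); split; last first.
  apply: (@synthesis_decomposable _ _ n c) => q q' x qq' cq; rewrite /= -rmorphM /=.
  by rewrite uc.
split=> //; [exact: eval_map_cpc|split|].
- exact: synthesis_cp wv.
- by apply: synthesis_contractive => // x; have [] := u1 x.
move=> l; rewrite C0_normE ltcR.
apply: (@le_lt_trans _ _ (d + d)); last by rewrite /d; lra.
apply: C0_norm_le => [|x]; first by rewrite addr_ge0 ?ltW.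
rewrite C0_subE synthesisE.
(* The first term averages oscillations, since [x] and [p q] share a [U i] when [u q x] is nonzero;
   the second vanishes on [K], and off [K] the value [b l x] is small. *)
have -> : \sum_q eval_map p (b l) q ord0 ord0 * w q x - b l x =
    \sum_q (b l (p q) - b l x) * (u q x)%:C%C - (1 - \sum_q u q x)%:C%C * b l x.
  have -> : \sum_q eval_map p (b l) q ord0 ord0 * w q x =
      \sum_q b l (p q) * (u q x)%:C%C by apply: eq_bigr => q _; rewrite mxE eqxx.
  under [in RHS]eq_bigr => q _ do rewrite mulrBl.
  rewrite sumrB -mulr_sumr rmorphB rmorph1 rmorph_sum /=; ring.
apply: le_trans (normcD _ _) _; rewrite normcN Normc.normcM normc_real.
have [ux1 uK] := u1 x; rewrite ger0_norm ?subr_ge0//.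
apply: (@le_trans _ _ ((\sum_q u q x) * (d + d) + (1 - \sum_q u q x) * (d + d))).
  apply: lerD.
    apply: le_trans (normc_sum _ _) _; rewrite mulr_suml; apply: ler_sum => q _.
    rewrite Normc.normcM normc_real ger0_norm// mulrC.
    have [->|uq] := eqVneq (u q x) 0; first by rewrite !mul0r.
    apply: ler_wpM2l => //; have [Vpq Vq] := Vp q.
    by apply: (bU (i q)); apply: VU => //; exact: Vq.
  have [/uK ->|/nK-/(_ l) bl] := pselect (K x); first by rewrite subrr !mul0r.
  apply: ler_wpM2l; first by rewrite subr_ge0.
  by apply: le_trans (ltW bl) _; rewrite lerDl ltW.
by rewrite -mulrDl addrC subrK mul1r.
Qed.

End UpperBound.

(** * From decomposition rank to covering dimension *)

Section RankOne.
Variables (R : realType) (I : finType) (r : I -> nat).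
Implicit Types (k : I) (v : nat -> R[i]).

(** Vectors are functions on [nat], of which only the values below [r k] matter;
    this spares casts between the summands. *)
Definition rank_one k v : fdalg R r :=
  fun l => \matrix_(a, b) (if l == k then v a * Num.conj (v b) else 0).

Definition matrix_unit k (a b : nat) : fdalg R r :=
  fun l => \matrix_(i, j) [&& l == k, nat_of_ord i == a & nat_of_ord j == b]%:R.

Lemma fd_starE (y : fdalg R r) k a b : star y k a b = Num.conj (y k b a).
Proof. by rewrite -[LHS]/(adjoint (y k) a b) !mxE. Qed.

Lemma fd_mulE (y z : fdalg R r) k a b : (y ** z) k a b = \sum_c y k a c * z k c b.
Proof. by rewrite -[LHS]/((y k *m z k) a b) mxE. Qed.

Lemma fd_scaleE (t : R[i]) (y : fdalg R r) k a b : (t *: y) k a b = t * y k a b.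
Proof. by rewrite -[LHS]/((t *: y k) a b) mxE. Qed.

Lemma fd_eqP (y z : fdalg R r) : (forall k a b, y k a b = z k a b) -> y = z.
Proof. by move=> yz; apply: fd_eq => k; apply/matrixP => a b. Qed.

Lemma fd_sumE (J : Type) (s : seq J) (P : pred J) (F : J -> fdalg R r) k a b :
  (\sum_(j <- s | P j) F j) k a b = \sum_(j <- s | P j) F j k a b.
Proof.
elim/big_rec2: _ => [|j y z _ <-]; first by rewrite mxE.
by rewrite -[LHS]/((F j k + z k) a b) mxE.
Qed.

Lemma star_rank_one k v : star (rank_one k v) = rank_one k v.
Proof.
apply: fd_eqP => l a b; rewrite fd_starE !mxE; case: ifP => _; last exact: rmorph0.
by rewrite rmorphM /= conjCK mulrC.
Qed.

Lemma rank_one_compress k v (q : fdalg R r) :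
  rank_one k v ** (q ** rank_one k v) =
  (\sum_(c < r k) \sum_(d < r k) Num.conj (v c) * q k c d * v d) *: rank_one k v.
Proof.
apply: fd_eqP => l; have [->|lk] := eqVneq l k => a b; last first.
  rewrite fd_mulE fd_scaleE mxE (negPf lk) mulr0 big1// => c _.
  by rewrite mxE (negPf lk) mul0r.
rewrite fd_mulE fd_scaleE mxE eqxx mulr_suml; apply: eq_bigr => c _.
rewrite fd_mulE mxE eqxx mulr_suml mulr_sumr.
by apply: eq_bigr => d _; rewrite mxE eqxx; ring.
Qed.

Lemma rank_one_mul k v v' :
  rank_one k v ** rank_one k v' = fun l => \matrix_(a, b) (if l == k then
    (\sum_(c < r k) Num.conj (v c) * v' c) * (v a * Num.conj (v' b)) else 0).
Proof.
apply: fd_eqP => l; have [->|lk] := eqVneq l k => a b; rewrite fd_mulE [RHS]mxE.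
  by rewrite mulr_suml; apply: eq_bigr => c _; rewrite !mxE eqxx; ring.
by rewrite big1// => c _; rewrite !mxE (negPf lk) mul0r.
Qed.

(** A subprojection [q] of [p] equals [p q p], which is a scalar multiple [t p] by
    [rank_one_compress]; idempotence forces [t] to be 0 or 1. *)
Lemma rank_one_minimal k v : \sum_(a < r k) Num.conj (v a) * v a = 1 ->
  minimal_projection (rank_one k v).
Proof.
move=> v1.
have pp : rank_one k v ** rank_one k v = rank_one k v.
  by rewrite rank_one_mul v1; apply: fd_eqP => l a b; rewrite !mxE mul1r.
have p0 : rank_one k v != 0.
  apply/eqP => p0; suff : (1 : R[i]) = 0 by apply/eqP; exact: oner_neq0.
  rewrite -v1 big1// => a _; have := congr1 (fun y : fdalg R r => y k a a) p0.
  by rewrite !mxE eqxx mulrC.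
split=> //; first by split; [exact: star_rank_one|].
move=> q [q_star qq] qp.
have pq : rank_one k v ** q = q by rewrite -{1}q_star -star_rank_one -starM qp.
have qE := rank_one_compress k v q; rewrite qp pq in qE.
move: (\sum_c _) qE => t qE.
have : (t * t - t) *: rank_one k v = 0.
  have := qq; rewrite qE cmulZl cmulZr scalerA pp scalerBl => ->; exact: subrr.
move/eqP; rewrite scaler_eq0 (negPf p0) orbF -[X in _ - X]mulr1 -mulrBr mulf_eq0 subr_eq0.
by rewrite qE => /orP[/eqP ->|/eqP ->]; [left; rewrite scale0r|right; rewrite scale1r].
Qed.

End RankOne.

(** * Order zero maps into C0(X) on matrix blocks *)

Section OrderZeroBlocks.
Variables (R : realType) (X : topologicalType) (I : finType) (r : I -> nat) (n : nat).
Variable phi : {linear fdalg R r -> C0 R X}.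
Variable c : I -> 'I_n.+1.
Hypothesis phi_order_zero : forall j : 'I_n.+1,
  strict_order_zero (phi \o @fd_incl R I r (fun k => c k == j)).

Lemma fd_incl_rank_one (P : pred I) k (Pk : P k) v :
  fd_incl (@rank_one R _ (fun k : {k | P k} => r (val k)) (exist _ k Pk) v) =
  @rank_one R I r k v.
Proof.
apply: fd_eq => l; rewrite /fd_incl; case: {-}_ / (@idP (P l)) => [Pl|nPl].
  by apply/matrixP => a b; rewrite !mxE -val_eqE.
by apply/matrixP => a b; rewrite !mxE; case: eqP => // lk; rewrite lk in nPl.
Qed.

Lemma order_zero_rank_one k k' (v v' : nat -> R[i]) x : c k = c k' ->
  \sum_(a < r k) Num.conj (v a) * v a = 1 ->
  \sum_(a < r k') Num.conj (v' a) * v' a = 1 ->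
  (k = k' -> \sum_(a < r k) Num.conj (v a) * v' a = 0) ->
  phi (rank_one r k v) x * phi (rank_one r k' v') x = 0.
Proof.
move=> ckk' v1 v'1 vv'.
have Pk : c k == c k' by apply/eqP.
have Pk' : c k' == c k' by [].
pose rs (l : {l | c l == c k'}) := r (val l).
have := @phi_order_zero (c k') (rank_one rs (exist _ k Pk) v)
  (rank_one rs (exist _ k' Pk') v').
rewrite /comp !fd_incl_rank_one => H.
rewrite -C0_mulE H//; [exact: rank_one_minimal|exact: rank_one_minimal|].
apply: fd_eqP => l a b; rewrite fd_mulE [RHS]mxE.
under eq_bigr => d _ do rewrite !mxE.
move: a b; have [->|lk] := eqVneq l (exist _ k Pk) => a b; last first.
  by rewrite big1// => d _; rewrite mul0r.
rewrite -val_eqE /=; have [kk'|kk'] := eqVneq k k'; last first.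
  by rewrite big1// => d _; rewrite mulr0.
transitivity (v a * Num.conj (v' b) * \sum_(d < r k) Num.conj (v d) * v' d).
  by rewrite mulr_sumr; apply: eq_bigr => d _; ring.
by rewrite vv'// mulr0.
Qed.

End OrderZeroBlocks.

Section BlocksVanish.
Variables (R : realType) (X : topologicalType) (I : finType) (r : I -> nat) (n : nat).
Variable phi : {linear fdalg R r -> C0 R X}.
Variable c : I -> 'I_n.+1.
Hypothesis phi_order_zero : forall j : 'I_n.+1,
  strict_order_zero (phi \o @fd_incl R I r (fun k => c k == j)).
Implicit Types (k : I) (x : X).

Local Notation E := (matrix_unit R r).

Definition vec2 (a b : nat) (s t : R[i]) (j : nat) : R[i] :=
  if j == a then s else if j == b then t else 0.

Lemma sum_vec2 m a b (s t s' t' : R[i]) : (a < m)%N -> (b < m)%N -> a != b ->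
  \sum_(j < m) Num.conj (vec2 a b s t j) * vec2 a b s' t' j =
  Num.conj s * s' + Num.conj t * t'.
Proof.
move=> am bm ab; rewrite (bigD1 (Ordinal am))//= (bigD1 (Ordinal bm))/=; last first.
  by rewrite -val_eqE /= eq_sym.
rewrite /vec2 !eqxx (eq_sym b a) (negPf ab) big1 ?addr0// => j /andP[].
by rewrite -!val_eqE /= => /negPf -> /negPf ->; rewrite mulr0.
Qed.

Lemma rank_one_vec2 k a b (s t : R[i]) : a != b ->
  rank_one r k (vec2 a b s t) = (s * Num.conj s) *: E k a a +
    (s * Num.conj t) *: E k a b + (t * Num.conj s) *: E k b a + (t * Num.conj t) *: E k b b.
Proof.
move=> ab; apply: fd_eqP => l i j.
rewrite -[RHS]/((_ *: E k a a l + _ *: E k a b l + _ *: E k b a l + _ *: E k b b l) i j).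
rewrite !mxE /vec2; case: (l == k) => /=; last by rewrite !mulr0 !addr0.
have [->|ia] := eqVneq (i : nat) a; rewrite /= ?(negPf ab) ?mulr0 ?add0r ?addr0.
  have [->|ja] := eqVneq (j : nat) a; rewrite /= ?(negPf ab) ?mulr0 ?mulr1 ?add0r ?addr0//.
  by case: eqP => _; rewrite ?mulr1// rmorph0 !mulr0.
case: (eqVneq (i : nat) b) => _; rewrite /= ?mulr0 ?mul0r ?addr0//.
have [->|ja] := eqVneq (j : nat) a; rewrite /= ?(negPf ab) ?mulr0 ?mulr1 ?add0r ?addr0//.
by case: eqP => _; rewrite ?mulr1// rmorph0 !mulr0.
Qed.

(* [A], [D] are the values on the diagonal units of a 2x2 corner, [Y] that on the
   off-diagonal part; the equations say that two pairs of orthogonal rank-one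
   projections, with coordinates 3/5 and 4/5, have product zero. *)
Lemma corner_algebra (A D Y : R[i]) : A * D = 0 ->
  (9 * A + 16 * D + 12 * Y) * (16 * A + 9 * D - 12 * Y) = 0 ->
  (9 * A + 16 * D - 12 * Y) * (16 * A + 9 * D + 12 * Y) = 0 ->
  [/\ A = 0, D = 0 & Y = 0].
Proof.
move=> AD H1 H2.
have nz m : m.+1%:R != 0 :> R[i] by rewrite pnatr_eq0.
have e1 : Y ^+ 2 = A ^+ 2 + D ^+ 2.
  apply: (mulfI (nz 287)); apply/eqP; rewrite -subr_eq0; apply/eqP.
  transitivity (2 * 337 * (A * D) - (9 * A + 16 * D + 12 * Y) * (16 * A + 9 * D - 12 * Y)
    - (9 * A + 16 * D - 12 * Y) * (16 * A + 9 * D + 12 * Y)); first by ring.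
  by rewrite AD H1 H2 mulr0 !subr0.
have e2 : Y * (A - D) = 0.
  apply: (mulfI (nz 167)); rewrite mulr0.
  transitivity ((9 * A + 16 * D + 12 * Y) * (16 * A + 9 * D - 12 * Y)
    - (9 * A + 16 * D - 12 * Y) * (16 * A + 9 * D + 12 * Y)); first by ring.
  by rewrite H1 H2 subr0.
have Y0 : Y = 0.
  have /eqP : (Y ^+ 2) ^+ 2 = 0.
    transitivity ((Y * (A - D)) ^+ 2 + Y ^+ 2 * (2 * (A * D))).
      by rewrite {1}expr2 {2}e1; ring.
    by rewrite e2 AD expr0n /= !mulr0 addr0.
  by rewrite !expf_eq0 /= => /eqP.
have e3 : A ^+ 2 + D ^+ 2 = 0 by rewrite -e1 Y0 expr0n.
have DA : D = - A.
  apply/eqP; rewrite -subr_eq0 opprK addrC -sqrf_eq0.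
  have -> : (A + D) ^+ 2 = (A ^+ 2 + D ^+ 2) + 2 * (A * D) by ring.
  by rewrite e3 AD mulr0 addr0.
have /eqP : A ^+ 2 = 0 by apply/eqP; rewrite -oppr_eq0 expr2 -mulrN -DA AD.
by rewrite sqrf_eq0 => /eqP A0; rewrite DA A0 oppr0.
Qed.

Lemma C0_addE (f g : C0 R X) x : (f + g) x = f x + g x. Proof. by []. Qed.
Lemma C0_scaleE (t : R[i]) (f : C0 R X) x : (t *: f) x = t * f x. Proof. by []. Qed.

(** Twisting one coordinate by a phase [w] turns orthogonality into the relations of
    [corner_algebra] with [Y = conj w * al + w * be]; two phases then separate [al] from [be]. *)
Lemma order_zero_corner k a b x : (a < r k)%N -> (b < r k)%N -> a != b ->
  phi (E k a b) x = 0 /\ phi (E k a a) x = 0.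
Proof.
move=> ak bk ab.
set A := phi (E k a a) x; set D := phi (E k b b) x.
set al := phi (E k a b) x; set be := phi (E k b a) x.
have value s t : phi (rank_one r k (vec2 a b s t)) x =
    s * Num.conj s * A + s * Num.conj t * al + t * Num.conj s * be + t * Num.conj t * D.
  by rewrite rank_one_vec2// !linearD /= !linearZ /=.
have product s t s' t' : Num.conj s * s + Num.conj t * t = 1 ->
    Num.conj s' * s' + Num.conj t' * t' = 1 -> Num.conj s * s' + Num.conj t * t' = 0 ->
    phi (rank_one r k (vec2 a b s t)) x * phi (rank_one r k (vec2 a b s' t')) x = 0.
  move=> st st' o; apply: (order_zero_rank_one phi_order_zero) => //.
  - by rewrite sum_vec2.
  - by rewrite sum_vec2.
  - by move=> _; rewrite sum_vec2.
have AD : A * D = 0.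
  have := @product 1 0 0 1; rewrite !value rmorph0 rmorph1 !mulr0 !mul0r !mulr1 !mul1r.
  by rewrite !addr0 !add0r; apply.
(* The orthonormal vectors [(3/5, 4/5 w)] and [(4/5, -3/5 w)] are used; the triple 3, 4, 5 keeps the
   coefficients rational, and 25 clears denominators. *)
have key w : Num.conj w * w = 1 -> (9 * A + 16 * D + 12 * (Num.conj w * al + w * be)) *
    (16 * A + 9 * D - 12 * (Num.conj w * al + w * be)) = 0.
  move=> w1.
  have cr (p q : nat) : Num.conj (p%:R / q%:R : R[i]) = p%:R / q%:R.
    by rewrite rmorphM /= fmorphV !rmorph_nat.
  have c3 : Num.conj (3 / 5 : R[i]) = 3 / 5 := cr 3%N 5%N.
  have c4 : Num.conj (4 / 5 : R[i]) = 4 / 5 := cr 4%N 5%N.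
  have cw : Num.conj (4 / 5 * w) = 4 / 5 * Num.conj w by rewrite rmorphM /= c4.
  have cw' : Num.conj (- (3 / 5) * w) = - (3 / 5) * Num.conj w.
    by rewrite rmorphM rmorphN /= c3.
  have -> : 9 * A + 16 * D + 12 * (Num.conj w * al + w * be) =
      25 * phi (rank_one r k (vec2 a b (3 / 5) (4 / 5 * w))) x.
    rewrite value cw c3; transitivity (9 * A + 16 * (Num.conj w * w) * D +
      12 * (Num.conj w * al + w * be)); [by rewrite w1 mulr1|by field].
  have -> : 16 * A + 9 * D - 12 * (Num.conj w * al + w * be) =
      25 * phi (rank_one r k (vec2 a b (4 / 5) (- (3 / 5) * w))) x.
    rewrite value cw' c4; transitivity (16 * A +
      9 * (Num.conj w * w) * D - 12 * (Num.conj w * al + w * be));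
      [by rewrite w1 mulr1|by field].
  rewrite mulrACA product ?mulr0// ?cw ?cw' ?c3 ?c4.
  - by transitivity ((9 + 16 * (Num.conj w * w)) / 25 : R[i]); [|rewrite w1]; field.
  - by transitivity ((16 + 9 * (Num.conj w * w)) / 25 : R[i]); [|rewrite w1]; field.
  - by transitivity (12 * (1 - Num.conj w * w) / 25 : R[i]); [|rewrite w1]; field.
have Hw w : Num.conj w * w = 1 -> [/\ A = 0, D = 0 & Num.conj w * al + w * be = 0].
  move=> w1; apply: corner_algebra => //; first exact: key.
  (* Passing to [- w] flips the sign of [Y] and yields the second relation. *)
  have := key (- w); rewrite rmorphN mulrNN => /(_ w1).
  by rewrite !mulNr -opprD mulrN opprK.
have [A0 _ Y1] : [/\ A = 0, D = 0 & Num.conj 1 * al + 1 * be = 0].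
  by apply: Hw; rewrite rmorph1 mulr1.
(* Phase 1 gives [al + be = 0] and phase ['i] gives [be - al = 0]. *)
have [_ _ Yi] : [/\ A = 0, D = 0 & Num.conj 'i * al + 'i * be = 0].
  by apply: Hw; rewrite conjCi mulNr -expr2 sqrCi opprK.
split=> //; move: Y1 Yi; rewrite rmorph1 !mul1r conjCi => /eqP.
rewrite addr_eq0 => /eqP ->; rewrite mulrNN -mulrDr => /eqP.
rewrite mulf_eq0 (negPf (neq0Ci _)) /= -mulr2n mulrn_eq0 /= => /eqP ->.
by rewrite oppr0.
Qed.

End BlocksVanish.

(** * Weights and scalar coefficients of an approximation *)

Section Approximation.
Variables (R : realType) (X : topologicalType) (I : finType) (r : I -> nat) (n : nat).
Hypothesis r_gt0 : forall k, (0 < r k)%N.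
Variable psi : {linear C0 R X -> fdalg R r}.
Variable phi : {linear fdalg R r -> C0 R X}.
Hypotheses (psi_cpc : cpc psi) (phi_cpc : cpc phi).
Variable c : I -> 'I_n.+1.
Hypothesis phi_order_zero : forall j : 'I_n.+1,
  strict_order_zero (phi \o @fd_incl R I r (fun k => c k == j)).
Implicit Types (k : I) (x : X).
Local Opaque opnorm.

Local Notation E := (matrix_unit R r).
Local Notation o k := (Ordinal (r_gt0 k)).

Lemma fd_sum_units (y : fdalg R r) :
  y = \sum_k \sum_(a < r k) \sum_(b < r k) y k a b *: E k a b.
Proof.
apply: fd_eqP => l i j; rewrite fd_sumE (bigD1 l)//= [X in _ + X]big1 => [|k kl].
  rewrite addr0 fd_sumE (bigD1 i)//= [X in _ + X]big1 => [|a ai].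
    rewrite addr0 fd_sumE (bigD1 j)//= [X in _ + X]big1 => [|b bj].
      by rewrite addr0 fd_scaleE mxE !eqxx mulr1.
    by rewrite fd_scaleE mxE -[nat_of_ord j == _]/(j == b) [j == b]eq_sym (negPf bj) !andbF mulr0.
  rewrite fd_sumE big1// => b _.
  by rewrite fd_scaleE mxE -[nat_of_ord i == _]/(i == a) [i == a]eq_sym (negPf ai) andbF mulr0.
rewrite fd_sumE big1// => a _; rewrite fd_sumE big1// => b _.
by rewrite fd_scaleE mxE eq_sym (negPf kl) mulr0.
Qed.

(* Only the one-dimensional summands contribute: the others are killed by [phi]. *)
Lemma phi_expand (y : fdalg R r) x :
  phi y x = \sum_k y k (o k) (o k) * phi (E k 0 0) x.
Proof.
rewrite {1}(fd_sum_units y) linear_sum C0_sumE; apply: eq_bigr => k _.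
rewrite linear_sum C0_sumE.
have lin (a b : 'I_(r k)) : phi (y k a b *: E k a b) x = y k a b * phi (E k a b) x.
  by rewrite linearZ.
have [r1|r2] := leqP (r k) 1.
  have ro (a : 'I_(r k)) : a = o k.
    by apply/val_inj => /=; case: a => [[|a] ar]//=; have := leq_trans ar r1.
  rewrite (bigD1 (o k))//= [X in _ + X]big1 ?addr0 => [|a]; last by rewrite (ro a) eqxx.
  rewrite linear_sum C0_sumE (bigD1 (o k))//= [X in _ + X]big1 ?addr0 => [|a].
    exact: lin.
  by rewrite (ro a) eqxx.
have zero (a b : 'I_(r k)) : phi (E k a b) x = 0.
  have [->|ab] := eqVneq a b; last first.
    by have [] := order_zero_corner phi_order_zero x (ltn_ord a) (ltn_ord b) ab.
  have [b0|b0] := eqVneq (b : nat) 0%N.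
    have b1 : (b : nat) != 1%N by rewrite b0.
    by have [] := order_zero_corner phi_order_zero x (ltn_ord b) r2 b1.
  by have [] := order_zero_corner phi_order_zero x (ltn_ord b) (r_gt0 k) b0.
rewrite big1 => [|a _]; first by rewrite (zero (o k) (o k)) mulr0.
by rewrite linear_sum C0_sumE big1// => b _; rewrite lin zero mulr0.
Qed.

Definition weight k x : R := complex.Re (phi (E k 0 0) x).

Lemma conj_mul_sqr (z : R[i]) : Num.conj z * z = (normc z ^+ 2)%:C%C.
Proof. by rewrite rmorphXn /= -normE normCK mulrC. Qed.

Lemma E_square k : star (E k 0 0) ** E k 0 0 = E k 0 0.
Proof.
apply: fd_eqP => l i j; rewrite fd_mulE mxE; have [lk|lk] := boolP (l == k); last first.
  by rewrite big1// => d _; rewrite !mxE (negPf lk) mulr0.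
have rl : (0 < r l)%N by rewrite (eqP lk).
rewrite (bigD1 (Ordinal rl))//= big1 => [|d]; last first.
  rewrite -val_eqE /= => d0; rewrite fd_starE !mxE lk (negPf d0) /=.
  by rewrite mulr0.
by rewrite fd_starE !mxE lk /= addr0 rmorph_nat -natrM mulnb.
Qed.

(** Complete positivity is applied to 1 x 1 matrices; the unit [E k 0 0] is a projection, hence its
    own root. *)
Lemma phi_unit_ge0 k x : phi (E k 0 0) x = (weight k x)%:C%C /\ 0 <= weight k x.
Proof.
have [cp _] := phi_cpc.
have /cp[b Hb] : mx_positive (\matrix_(i < 1, j < 1) E k 0 0).
  by exists (\matrix_(i < 1, j < 1) E k 0 0) => i j; rewrite big_ord1 !mxE E_square.
have := Hb ord0 ord0; rewrite big_ord1 !mxE => H.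
have e : phi (E k 0 0) x = (normc (b ord0 ord0 x) ^+ 2)%:C%C.
  by rewrite H C0_mulE C0_starE conj_mul_sqr.
by rewrite /weight e /= sqr_ge0.
Qed.

Lemma weight_continuous k : continuous (weight k).
Proof.
move=> x; apply/cvgrPdist_lt => e e0.
apply: filterS (C0_near (phi (E k 0 0)) x e0) => y.
by rewrite (phi_unit_ge0 k x).1 (phi_unit_ge0 k y).1 -rmorphB normc_real.
Qed.

Lemma weight_disjoint k k' x : k != k' -> c k = c k' -> weight k x * weight k' x = 0.
Proof.
move=> kk' ckk'; apply: complexI; rewrite rmorphM /=.
rewrite -(phi_unit_ge0 k x).1 -(phi_unit_ge0 k' x).1.
have rE l : E l 0 0 = rank_one r l (fun a => (a == 0%N)%:R).
  apply: fd_eqP => l' i j; rewrite !mxE rmorph_nat -natrM mulnb.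
  by case: (l' == l).
have sE l : \sum_(a < r l) Num.conj ((a == 0%N :> nat)%:R : R[i]) * (a == 0%N :> nat)%:R = 1.
  rewrite (bigD1 (o l))//= big1 ?rmorph1 ?mulr1 ?addr0// => a; rewrite -val_eqE /=.
  by move=> /negPf ->; rewrite mulr0.
rewrite !rE; apply: (order_zero_rank_one phi_order_zero) => // kk'E.
by rewrite kk'E eqxx in kk'.
Qed.

(** The sum is the value at [x] of the image of the unit, and [phi] is contractive. *)
Lemma weight_sum_le1 x : \sum_k weight k x <= 1.
Proof.
pose y : fdalg R r := fun k => 1%:M.
have y1 : fd_norm y <= 1.
  by apply: fd_norm_le => // k; apply: opnorm_le => v; rewrite mul1mx.
have [_ /(_ y)] := phi_cpc; rewrite fd_normE C0_normE lecR => phi1.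
have := le_trans (C0_norm_ub (phi y) x) (le_trans phi1 y1).
rewrite phi_expand.
have -> : \sum_k y k (o k) (o k) * phi (E k 0 0) x = (\sum_k weight k x)%:C%C.
  rewrite rmorph_sum /=; apply: eq_bigr => k _.
  by rewrite mxE eqxx mul1r (phi_unit_ge0 k x).1.
rewrite normc_real ger0_norm//; apply: sumr_ge0 => k _.
exact: (phi_unit_ge0 k x).2.
Qed.

Definition coefficient k (f : C0 R X) : R := complex.Re (psi f k (o k) (o k)).

Lemma approximation_Re f x :
  complex.Re (phi (psi f) x) = \sum_k coefficient k f * weight k x.
Proof.
rewrite phi_expand raddf_sum; apply: eq_bigr => k _.
rewrite (phi_unit_ge0 k x).1 /coefficient.
by case: (psi f k _ _) => a b /=; rewrite mulr0 subr0.
Qed.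

Lemma coefficient_le k f : coefficient k f <= C0_norm f.
Proof.
have [_ /(_ f)] := psi_cpc; rewrite fd_normE C0_normE lecR.
apply: le_trans; apply: le_trans (fd_norm_ub (psi f) k).
apply: le_trans (opnorm_entry _ (o k) (o k)).
rewrite /coefficient; case: (psi f k _ _) => a b /=.
by rewrite (le_trans (ler_norm _))// -sqrtr_sqr ler_sqrt ?addr_ge0 ?sqr_ge0// lerDl sqr_ge0.
Qed.

Lemma coefficient_square_ge0 k f : 0 <= coefficient k (star f ** f).
Proof.
have [cp _] := psi_cpc.
have /cp[b Hb] : mx_positive (\matrix_(i < 1, j < 1) (star f ** f)).
  by exists (\matrix_(i < 1, j < 1) f) => i j; rewrite big_ord1 !mxE.
have := Hb ord0 ord0; rewrite big_ord1 !mxE => H.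
rewrite /coefficient H fd_mulE raddf_sum; apply: sumr_ge0 => d _.
by rewrite fd_starE conj_mul_sqr sqr_ge0.
Qed.

Lemma coefficientD k f g : coefficient k (f + g) = coefficient k f + coefficient k g.
Proof.
rewrite /coefficient linearD /=.
have -> : (psi f + psi g) k (o k) (o k) = psi f k (o k) (o k) + psi g k (o k) (o k).
  by rewrite -[LHS]/((psi f k + psi g k) (o k) (o k)) mxE.
exact: raddfD.
Qed.

Lemma coefficientZ k (t : R) f : coefficient k (t%:C%C *: f) = t * coefficient k f.
Proof.
rewrite /coefficient linearZ /= fd_scaleE.
by case: (psi f k _ _) => a b /=; rewrite mul0r subr0.
Qed.

(* Kadison's inequality, from positivity at [(f - t g)^2]; [g] stands in for the
   missing unit. *)
Lemma coefficient_kadison k (f g : C0 R X) : star f = f -> star g = g ->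
  f ** g = f -> C0_norm (g ** g) <= 1 ->
  coefficient k f ^+ 2 <= coefficient k (f ** f).
Proof.
move=> sf sg fg g1; set t := coefficient k f.
have := coefficient_square_ge0 k (f + (- t)%:C%C *: g).
rewrite (_ : star _ ** _ =
    f ** f + ((- (2 * t))%:C%C *: f + (t ^+ 2)%:C%C *: (g ** g))); last first.
  rewrite starD sf starZ conj_real_complex sg.
  apply: C0_eq => x; have := congr1 (fun h : C0 R X => h x) fg; rewrite C0_mulE => fgx.
  rewrite C0_mulE !C0_addE !C0_scaleE !C0_mulE.
  rewrite -[X in _ = _ + (_ * X + _)]fgx rmorphXn !rmorphN rmorphM /=.
  rewrite (_ : (2 : R)%:C%C = 2 :> R[i]) ?rmorph_nat//; ring.
rewrite !coefficientD !coefficientZ -/t.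
have := le_trans (coefficient_le k (g ** g)) g1.
have := sqr_ge0 t; nra.
Qed.

End Approximation.

(** Within each of the [n.+1] colours at most one [w k] is nonzero. *)
Lemma at_most_one_color (R : realType) (I : finType) n (c : I -> 'I_n.+1) (w : I -> R)
    (e : R) : 0 <= e -> (forall k, w k <= e) ->
  (forall k k', k != k' -> c k = c k' -> w k * w k' = 0) ->
  \sum_k w k <= n.+1%:R * e.
Proof.
move=> e0 we wc; rewrite (partition_big c predT)//=.
apply: (@le_trans _ _ (\sum_(j < n.+1) e)); last first.
  by rewrite sumr_const card_ord mulr_natl.
apply: ler_sum => j _; have [[k ck wk]|all0] := pselect (exists2 k, c k == j & w k != 0).
  rewrite (bigD1 k)//= big1 ?addr0// => k' /andP[ck' kk'].
  have /eqP := wc _ _ kk' (etrans (eqP ck') (esym (eqP ck))).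
  by rewrite mulf_eq0 (negPf wk) orbF => /eqP.
rewrite big1// => k ck; apply/eqP; apply: contrapT => /negP wk.
by apply: all0; exists k.
Qed.

(** * Refining covers of compact sets by means of approximations *)

Section LowerBound.
Variables (R : realType) (X : topologicalType).
Hypothesis X_lc : locally_compact [set: X].
Hypothesis X_hausdorff : hausdorff_space X.

Lemma local_refinement n (K : set X) (I : finType) (U : I -> set X) :
  decomposition_rank_le (C0 R X) n -> compact K -> (forall i, open (U i)) ->
  K `<=` \bigcup_i U i ->
  exists W : I -> set X, [/\ forall i, open (W i), forall i, W i `<=` U i,
    K `<=` \bigcup_i W i & order_le W n].
Proof.
move=> dr cK oU KU.
have [h [ch h01 hK [C CU hC]]] := @bump_family R X X_lc X_hausdorff I K U cK oU KU.
have hs i : exists2 D, compact D & forall x, ~ D x -> h i x = 0.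
  by exists (C i); [exact: (CU i).1|exact: hC].
(* On [K'], which contains [K] and the supports of all [h i], the function [g] will be 1; thus [G]
   acts as a unit on every [H i]. *)
pose K' := K `|` \big[setU/set0]_i C i.
have cK' : compact K'.
  by apply: compactU => //; apply: bigsetU_compact => i _; exact: (CU i).1.
have [x _|g [cg g01 gK [D DU gD]]] := @bump_family R X X_lc X_hausdorff unit K'
    (fun=> setT) cK' (fun=> openT); first by exists tt.
have gs : exists2 D, compact D & forall x, ~ D x -> g tt x = 0.
  by exists (D tt); [exact: (DU tt).1|exact: gD].
have g1 x : K' x -> g tt x = 1 by move=> /gK[[]].
pose H i : C0 R X := real_C0 (@ch i) (hs i).
pose G : C0 R X := real_C0 (@cg tt) gs.
have HG i : H i ** G = H i.
  apply: C0_eq => x; rewrite C0_mulE /= -rmorphM /=.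
  have [Cx|nCx] := pselect (C i x); last by rewrite hC// mul0r.
  by rewrite g1 ?mulr1//; right; rewrite -bigcup_seq; exists i; rewrite //= mem_index_enum.
have star_real (u : X -> R) cu us : star (@real_C0 R X u cu us) = real_C0 cu us.
  by apply: C0_eq => x; rewrite C0_starE conj_real_complex.
have GG : C0_norm (G ** G) <= 1.
  apply: C0_norm_le => // x; rewrite C0_mulE -rmorphM normc_real.
  by have /andP[g0 g1'] := g01 tt x; rewrite ger0_norm ?mulr_ge0// mulr_ile1.
have G1 : C0_norm G <= 1.
  apply: C0_norm_le => // x; rewrite normc_real.
  by have /andP[g0 ?] := g01 tt x; rewrite ger0_norm.
pose N : R := n.+1%:R; have N0 : 0 < N by rewrite ltr0n.
have N1 : 1 <= N by rewrite ler1n.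
(* If no weight exceeded [eta] at a point, the weights would sum to at most [N * eta], that is
   1/2. *)
pose eta : R := (2 * N)^-1; have eta0 : 0 < eta by rewrite invr_gt0 mulr_gt0.
have etaN : N * eta = 2^-1 by rewrite /eta invfM mulrCA divff ?mulr1// gt_eqF.
have eta1 : eta <= 2^-1 by rewrite -etaN ler_peMl// ltW.
(* The factor 64 turns [3 * e] into [eta * (3 / 64)], and 3/64 is below the square of 1/4. *)
pose e := eta / 64; have e0 : 0 < e by rewrite divr_gt0.
pose b (t : option (bool * I)) : C0 R X :=
  if t is Some (s, i) then (if s then H i ** H i else H i) else G.
have [s [r [psi [phi [[r_gt0 psi_cpc phi_cpc approx] [c phi_c]]]]]] :=
  dr _ (fun l : 'I_#|{: option (bool * I)}| => b (enum_val l)) e e0.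
pose w := weight phi; pose lam := coefficient r_gt0 psi.
have w0 k x : 0 <= w k x := (phi_unit_ge0 r_gt0 phi_cpc k x).2.
have {}approx t x : `|\sum_k lam k (b t) * w k x - complex.Re (b t x)| < e.
  rewrite -(approximation_Re r_gt0 psi phi_cpc phi_c).
  have := approx (enum_rank t); rewrite enum_rankK C0_normE ltcR.
  apply: le_lt_trans; apply: le_trans (C0_norm_ub _ x); rewrite C0_subE.
  case: (phi _ x) (b t x) => p q [p' q'] /=.
  by rewrite -sqrtr_sqr ler_sqrt ?addr_ge0 ?sqr_ge0// lerDl sqr_ge0.
have w1 x : \sum_k w k x <= 1 := weight_sum_le1 r_gt0 phi_cpc phi_c x.
have close k i x : eta < w k x -> `|lam k (H i) - h i x| < 1 / 4.
  move=> wk; set t := h i x; have /andP[t0 t1] : 0 <= t <= 1 := h01 i x.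
  (* Kadison's inequality bounds the sum by a combination of approximated values: the square
     contributes [e], the linear term [2 * t * e], and [t] is at most 1. *)
  have S : \sum_k w k x * (lam k (H i) - t) ^+ 2 <= 3 * e.
    apply: (@le_trans _ _ (\sum_k lam k (H i ** H i) * w k x -
        2 * t * (\sum_k lam k (H i) * w k x) + t ^+ 2 * \sum_k w k x)).
      rewrite !mulr_sumr -sumrB -big_split /=; apply: ler_sum => k' _.
      have := coefficient_kadison r_gt0 psi_cpc k' (star_real _ _ _) (star_real _ _ _)
        (HG i) GG.
      move=> /(ler_wpM2r (w0 k' x)) kadison.
      rewrite (_ : w k' x * (lam k' (H i) - t) ^+ 2 = lam k' (H i) ^+ 2 * w k' x -
        2 * t * (lam k' (H i) * w k' x) + t ^+ 2 * w k' x); last by ring.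
      by rewrite !lerD2r.
    have := approx (Some (true, i)) x; have := approx (Some (false, i)) x => /=.
    rewrite mulr0 subr0 -/t !ltr_distl => /andP[a1 a2] /andP[a3 a4].
    have := ler_wpM2l (sqr_ge0 t) (w1 x).
    move: (\sum_k lam k (H i ** H i) * w k x) (\sum_k lam k (H i) * w k x) a1 a2 a3 a4.
    by move: (t ^+ 2 * \sum_k w k x) => u p q a1 a2 a3 a4 u1; nra.
  have : w k x * (lam k (H i) - t) ^+ 2 <= 3 * e.
    apply: le_trans S; rewrite [leRHS](bigD1 k)//= lerDl sumr_ge0// => k' _.
    by rewrite mulr_ge0 ?sqr_ge0.
  have -> : 3 * e = eta * (3 / 64) by rewrite /e; field.
  move=> wt; have {}wt : (lam k (H i) - t) ^+ 2 <= 3 / 64.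
    rewrite -(ler_pM2l eta0); apply: le_trans wt.
    by rewrite ler_wpM2r ?sqr_ge0// ltW.
  rewrite -ltr_sqr ?nnegrE// real_normK ?num_real//; lra.
pose O k := [set x | eta < w k x].
have oO k : open (O k).
  apply: (@open_comp _ _ (w k) [set t | eta < t]) => [x _|]; last exact: open_gt.
  exact: (weight_continuous r_gt0 phi_cpc).
have On : order_le O n.
  move=> l il; rewrite -subset0 => x Ox.
  (* Among [n.+2] indices two share one of the [n.+1] colours, and their weights are disjoint. *)
  have /injectivePn[p [q pq cpq]] : ~~ injectiveb (c \o l).
    by apply/injectiveP => /leq_card; rewrite !card_ord ltnn.
  have /eqP := weight_disjoint r_gt0 phi_cpc phi_c x (contra_neq (il p q) pq) cpq.
  by rewrite mulf_eq0 !gt_eqF//; apply: lt_trans eta0 _; exact: Ox.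
(* If [O k] meets [K], it is assigned an [i] with [h i] equal to 1 somewhere on it; [close] then
   keeps [h i] away from 0 on all of [O k]. Otherwise it gets [None]. *)
have Ha k : exists a : option I, (forall i, a = Some i -> exists2 y, O k y & h i y = 1) /\
    (forall y, K y -> O k y -> a <> None).
  have [[y [Ky Oy]]|no] := pselect (exists y, K y /\ O k y).
    by have [i hi] := hK y Ky; exists (Some i); split=> // _ [<-]; exists y.
  by exists None; split=> // y Ky Oy; exfalso; apply: no; exists y.
pose a k := projT1 (cid (Ha k)).
have aP k := projT2 (cid (Ha k)).
exists (fun i => \bigcup_(k in [set k | a k = Some i]) O k); split.
- by move=> i; apply: bigcup_open.
- move=> i x [k ak Ox]; have [/(_ i ak)[y Oy hy] _] := aP k.
  apply: (CU i).2; apply: contrapT => /hC hx.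
  have := close k i x Ox; have := close k i y Oy; rewrite hx hy.
  rewrite !ltr_distl => /andP[? ?] /andP[? ?]; lra.
- move=> x Kx; have [k Ok] : exists k, O k x.
    apply: contrapT => /forallNP nO.
    (* This contradicts the approximation of [G], whose value at [x] is 1 while its coefficients are
       at most 1. *)
    have : \sum_k w k x <= N * eta.
      apply: (at_most_one_color (c := c) (ltW eta0)) => [k|k k' kk' ckk'].
        by rewrite leNgt; apply/negP; exact: nO.
      exact: (weight_disjoint r_gt0 phi_cpc phi_c).
    have : \sum_k lam k G * w k x <= \sum_k w k x.
      apply: ler_sum => k _; rewrite ler_piMl//.
      exact: le_trans (coefficient_le r_gt0 psi_cpc k G) G1.
    have := approx None x; rewrite /= g1; last by left.
    rewrite ltr_distl etaN /e => /andP[? ?] ? ?; lra.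
  have [_ /(_ x Kx Ok)] := aP k.
  rewrite -/(a k); case ak : (a k) => [i|]// _.
  by exists i => //; exists k.
exact: order_le_merge.
Qed.

End LowerBound.

Theorem proposition3p4 (R : realType) (X : topologicalType)
    (X_second_countable : @second_countable X)
    (X_locally_compact : locally_compact [set: X])
    (X_hausdorff : hausdorff_space X) :
  decomposition_rank (C0 R X) = covering_dim X.
Proof.
have nX : normal_space X.
  exact: (second_countable_locally_compact_normal R).
rewrite /decomposition_rank /covering_dim; congr least.
apply/funext => n; apply/propext; split; last first.
  exact: decomposition_rank_le_covering_dim.
move=> dr.
have [K [cK KT]] := sigma_compact X_second_countable X_locally_compact X_hausdorff.
apply: (covering_dim_le_sum nX _ KT) => [m|m I U oU KU].
  exact: compact_closed.
exact: (local_refinement X_locally_compact X_hausdorff dr).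
Qed.
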